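(* A configuration $C$ is strongly normalizing (there is no infinite reduction sequence $C=C_1\to C_2\to\cdots$) if and only if it is weakly normalizing (there is a finite reduction sequence $C\to^* D$ with $D$ in normal form).
   Context: The Q-calculus. Terms: classical variables $x$; quantum variables $r$; patterns $\pi::=x\mid\langle x_1,\dots,x_n\rangle$; constants $0,1$ and symbols $U_i$ for a fixed effective enumeration $(\mathbf{U}_i)$ of computable unitary operators on $\mathbb{C}^{2^{n_i}}$; terms $M::=x\mid r\mid\ !M\mid C\mid \mathtt{new}(M)\mid (M_1)M_2\mid\langle M_1,\dots,M_n\rangle\ (n\ge2)\mid \lambda!x.M\mid\lambda\pi.M$ modulo $\alpha$-conversion. Well-formedness of judgements $\Gamma\vdash M$: axioms $\vdash C$, $r\vdash r$, $x\vdash x$; $\Gamma\vdash M\Rightarrow\Gamma,!x\vdash M$; $\Gamma,!x,!y\vdash M\Rightarrow\Gamma,!z\vdash M\{z/x,z/y\}$; $!\Gamma\vdash M\Rightarrow!\Gamma\vdash!M$; $\Gamma,x\vdash M\Rightarrow\Gamma,!x\vdash M$; $\Gamma,x_1,\dots,x_k\vdash M\Rightarrow\Gamma,\langle x_1,\dots,x_k\rangle\vdash M$; $\Gamma_i\vdash M_i\Rightarrow\Gamma_1,\dots,\Gamma_k\vdash\langle M_1,\dots,M_k\rangle$; $\Gamma\vdash M\Rightarrow\Gamma\vdash\mathtt{new}(M)$; $\Gamma,\pi\vdash M\Rightarrow\Gamma\vdash\lambda\pi.M$; $\Gamma,!x\vdash M\Rightarrow\Gamma\vdash\lambda!x.M$;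 $\Gamma_1\vdash M_1,\Gamma_2\vdash M_2\Rightarrow\Gamma_1,\Gamma_2\vdash(M_1)M_2$ (environments: multisets of patterns, $!x$'s and quantum variables, names at most once). Configurations $[\mathcal{Q},\mathcal{QV},M]$ ($\mathcal{QV}$ a finite set of quantum variables containing those of $M$, $\mathcal{Q}$ in the Hilbert space of functions $\{0,1\}^{\mathcal{QV}}\to\mathbb{C}$) are taken modulo bijective renaming of quantum variables and are assumed well formed ($\Gamma\vdash M$ well formed for some $\Gamma$). Reduction $\to$: ($\mathsf{Uq}$) $[\mathcal{Q},\mathcal{QV},U\langle r_1,\dots,r_n\rangle]\to[\mathbf{U}_{\langle\langle r_1,\dots,r_n\rangle\rangle}\mathcal{Q},\mathcal{QV},\langle r_1,\dots,r_n\rangle]$ (apply $\mathbf{U}$ to qubits $r_1,\dots,r_n$, identity elsewhere); ($\mathsf{new}$) $[\mathcal{Q},\mathcal{QV},\mathtt{new}(c)]\to[\mathcal{Q}\otimes|r\mapsto c\rangle,\mathcal{QV}\cup\{r\},r]$, $c\in\{0,1\}$, $r$ fresh; and with $\mathcal{Q},\mathcal{QV}$ unchanged $(\lambda x.M)N\to M\{N/x\}$, $(\lambda\langle x_1,\dots,x_n\rangle.M)\langle r_1,\dots,r_n\rangle\to M\{r_i/x_i\}_i$, $(\lambda!x.M)!N\to M\{N/x\}$, $L((\lambda\pi.M)N)\to(\lambda\pi.LM)N$, $((\lambda\pi.M)N)L\to(\lambda\pi.ML)N$; closed under tuple components, both sides of application and the body of $\lambda\pi.(\cdot)$ (not inside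 $!M$). A configuration is in normal form if it has no reduct.
   Formalization: Reduction is also closed under new(.) and the body of λ!x; otherwise (λx.new(x))Ω, with Ω=W!W and W=λ!x.x!x, reduces to the normal form new(Ω) and also to itself. One-qubit operators act on r itself, written ⟨r⟩. *)

(* Defs.v *)
From HB Require Import structures.
From Stdlib Require Import Permutation Relation_Operators.
From mathcomp Require Import all_boot all_order all_algebra spectral.
From mathcomp Require Import finmap reals complex.

Set Implicit Arguments.
Unset Strict Implicit.
Unset Printing Implicit Defensive.

Import GRing.Theory.

(** Terms modulo alpha-conversion.  Free classical variables are names; bound ones are de Bruijn references, so
   that a term is its own alpha-class.  A binder binds a whole pattern:
   [BVar k i] is the [i]-th variable of the pattern bound by the [k]-th
   enclosing lambda.  Tuples and tuple patterns have at least 2 components and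
   no reference is dangling: this is imposed by [wf], not by the syntax. *)

Inductive shape := SVar | STup of nat.

Inductive term :=
| FVar of nat
| BVar of nat & nat
| QVar of nat
| Bang of term
| Bit of bool
| Gate of nat
| New of term
| App of term & term
| Tup of seq term
| LamBang of term
| LamPat of shape & term.

Fixpoint qvars (M : term) : seq nat :=
  match M with
  | QVar r => [:: r]
  | Bang M | New M | LamBang M | LamPat _ M => qvars M
  | App M N => qvars M ++ qvars N
  | Tup Ms => flatten (map qvars Ms)
  | FVar _ | BVar _ _ | Bit _ | Gate _ => [::]
  end.

Fixpoint rename_q (s : nat -> nat) (M : term) : term :=
  match M with
  | QVar r => QVar (s r)
  | Bang M => Bang (rename_q s M)
  | New M => New (rename_q s M)
  | App M N => App (rename_q s M) (rename_q s N)
  | Tup Ms => Tup (map (rename_q s) Ms)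
  | LamBang M => LamBang (rename_q s M)
  | LamPat p M => LamPat p (rename_q s M)
  | FVar _ | BVar _ _ | Bit _ | Gate _ => M
  end.

Fixpoint rename_c (s : nat -> nat) (M : term) : term :=
  match M with
  | FVar x => FVar (s x)
  | Bang M => Bang (rename_c s M)
  | New M => New (rename_c s M)
  | App M N => App (rename_c s M) (rename_c s N)
  | Tup Ms => Tup (map (rename_c s) Ms)
  | LamBang M => LamBang (rename_c s M)
  | LamPat p M => LamPat p (rename_c s M)
  | QVar _ | BVar _ _ | Bit _ | Gate _ => M
  end.

(** Abstraction of the names [xs], under [c] binders of the term itself. *)
Fixpoint close (c : nat) (xs : seq nat) (M : term) : term :=
  match M with
  | FVar x => if x \in xs then BVar c (index x xs) else M
  | Bang M => Bang (close c xs M)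
  | New M => New (close c xs M)
  | App M N => App (close c xs M) (close c xs N)
  | Tup Ms => Tup (map (close c xs) Ms)
  | LamBang M => LamBang (close c.+1 xs M)
  | LamPat p M => LamPat p (close c.+1 xs M)
  | QVar _ | BVar _ _ | Bit _ | Gate _ => M
  end.

(** Weakening by one binder, inserted at level [c]. *)
Fixpoint lift_term (c : nat) (M : term) : term :=
  match M with
  | BVar k i => if k < c then M else BVar k.+1 i
  | Bang M => Bang (lift_term c M)
  | New M => New (lift_term c M)
  | App M N => App (lift_term c M) (lift_term c N)
  | Tup Ms => Tup (map (lift_term c) Ms)
  | LamBang M => LamBang (lift_term c.+1 M)
  | LamPat p M => LamPat p (lift_term c.+1 M)
  | FVar _ | QVar _ | Bit _ | Gate _ => M
  end.

(** Capture-avoiding substitution of [Ns] for the variables of the binder at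
   level [c], which disappears; the default of [nth] is never reached in a
   well-formed term. *)
Fixpoint inst (c : nat) (Ns : seq term) (M : term) : term :=
  match M with
  | BVar k i => if k < c then M
                else if k == c then nth (Bit false) Ns i
                else BVar k.-1 i
  | Bang M => Bang (inst c Ns M)
  | New M => New (inst c Ns M)
  | App M N => App (inst c Ns M) (inst c Ns N)
  | Tup Ms => Tup (map (inst c Ns) Ms)
  | LamBang M => LamBang (inst c.+1 (map (lift_term 0) Ns) M)
  | LamPat p M => LamPat p (inst c.+1 (map (lift_term 0) Ns) M)
  | FVar _ | QVar _ | Bit _ | Gate _ => M
  end.

Inductive pat := PVar of nat | PTup of seq nat.

Definition pat_vars (p : pat) : seq nat :=
  match p with PVar x => [:: x] | PTup xs => xs end.

Definition pat_shape (p : pat) : shape :=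
  match p with PVar _ => SVar | PTup xs => STup (size xs) end.

Inductive entry := EPat of pat | EBang of nat | EQ of nat.

Definition env := seq entry.

Definition cnames (G : env) : seq nat :=
  flatten [seq match e with
               | EPat p => pat_vars p | EBang x => [:: x] | EQ _ => [::]
               end | e <- G].

Definition qnames (G : env) : seq nat :=
  pmap (fun e => if e is EQ r then Some r else None) G.

Definition env_ok (G : env) : bool := uniq (cnames G) && uniq (qnames G).

Definition is_bang (e : entry) : bool := if e is EBang _ then true else false.

(** Environments are multisets, hence [wf_perm]; the side conditions [env_ok]
   appear in the rules that could otherwise break [env_ok]. *)
Inductive wf : env -> term -> Prop :=
| wf_perm G D M : Permutation G D -> wf G M -> wf D M
| wf_bit b : wf [::] (Bit b)
| wf_gate i : wf [::] (Gate i)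
| wf_qvar r : wf [:: EQ r] (QVar r)
| wf_cvar x : wf [:: EPat (PVar x)] (FVar x)
| wf_weak G x M :
    wf G M -> env_ok (EBang x :: G) -> wf (EBang x :: G) M
| wf_contr G x y z M :
    wf [:: EBang x, EBang y & G] M -> env_ok (EBang z :: G) ->
    wf (EBang z :: G)
       (rename_c (fun w => if (w == x) || (w == y) then z else w) M)
| wf_prom G M : all is_bang G -> wf G M -> wf G (Bang M)
| wf_der G x M : wf (EPat (PVar x) :: G) M -> wf (EBang x :: G) M
| wf_pat G xs M :
    2 <= size xs -> wf ([seq EPat (PVar x) | x <- xs] ++ G) M ->
    wf (EPat (PTup xs) :: G) M
| wf_tuple Gs Ms :
    2 <= size Ms -> size Gs = size Ms ->
    (forall i, i < size Ms -> wf (nth [::] Gs i) (nth (Bit false) Ms i)) ->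
    env_ok (flatten Gs) -> wf (flatten Gs) (Tup Ms)
| wf_new G M : wf G M -> wf G (New M)
| wf_lam_pat G p M :
    wf (EPat p :: G) M -> wf G (LamPat (pat_shape p) (close 0 (pat_vars p) M))
| wf_lam_bang G x M :
    wf (EBang x :: G) M -> wf G (LamBang (close 0 [:: x] M))
| wf_app G1 G2 M1 M2 :
    wf G1 M1 -> wf G2 M2 -> env_ok (G1 ++ G2) -> wf (G1 ++ G2) (App M1 M2).

(** Kleene's mu-recursive functions, with their graphs. *)

Inductive recfun :=
| RZero | RSucc | RProj of nat
| RComp of recfun & seq recfun | RPrec of recfun & recfun | RMin of recfun.

Inductive reval : recfun -> seq nat -> nat -> Prop :=
| ev_zero v : reval RZero v 0
| ev_succ n v : reval RSucc (n :: v) n.+1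
| ev_proj i v : i < size v -> reval (RProj i) v (nth 0 v i)
| ev_comp f gs v ws n :
    size ws = size gs ->
    (forall i, i < size gs -> reval (nth RZero gs i) v (nth 0 ws i)) ->
    reval f ws n -> reval (RComp f gs) v n
| ev_prec0 f g v n : reval f v n -> reval (RPrec f g) (0 :: v) n
| ev_precS f g m v n k :
    reval (RPrec f g) (m :: v) n -> reval g [:: m, n & v] k ->
    reval (RPrec f g) (m.+1 :: v) k
| ev_min f v n :
    reval f (n :: v) 0 ->
    (forall m, m < n -> exists k, reval f (m :: v) k.+1) ->
    reval (RMin f) v n.

(** [c] computes, from (i, a, b, k), an approximation (p - q) / 2^k of the real
   number [x i a b] with error at most 2^-k. *)
Definition approximates (R : realType) (c1 c2 : recfun) (i a b : nat) (x : R) :=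
  forall k : nat, exists p q : nat,
    [/\ reval c1 [:: i; a; b; k] p, reval c2 [:: i; a; b; k] q
      & (`|x - (p%:R - q%:R) / 2%:R ^+ k| <= (2%:R ^+ k)^-1)%R].

(** An effective enumeration of computable unitary operators on C^(2^n): the
   arities and the entries are computable, uniformly in the index. *)
Record gates (R : realType) := Gates {
  arity : nat -> nat;
  op : forall i, 'M[R[i]]_(2 ^ arity i);
  op_unitary : forall i, op i \is unitarymx;
  arity_computable : exists c, forall i, reval c [:: i] (arity i);
  op_computable : exists cs : recfun * recfun * (recfun * recfun),
    forall i (a b : 'I_(2 ^ arity i)),
      approximates cs.1.1 cs.1.2 i a b (complex.Re (op i a b)) /\
      approximates cs.2.1 cs.2.2 i a b (complex.Im (op i a b)) }.

(** |b_1 ... b_n> is the basis vector of C^(2^n) whose index has binary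
   expansion b_1 ... b_n, most significant bit first. *)
Definition bits_val (bs : seq bool) : nat :=
  foldl (fun (m : nat) (b : bool) => m.*2 + b) 0 bs.

Lemma bits_val_lt (bs : seq bool) : bits_val bs < 2 ^ size bs.
Proof.
elim/last_ind: bs => [//|bs b IH].
rewrite /bits_val foldl_rcons size_rcons expnS mul2n.
apply: (@leq_trans (bits_val bs).+1.*2); last by rewrite leq_double.
by rewrite doubleS ltnS -addn1 leq_add2l leq_b1.
Qed.

Definition basis_index n (bs : n.-tuple bool) : 'I_(2 ^ n) :=
  Ordinal (eq_ind (size bs) (fun m => bits_val bs < 2 ^ m) (bits_val_lt bs)
             n (size_tuple bs)).

Definition hilb (R : realType) (QV : {fset nat}) : Type :=
  {ffun {ffun QV -> bool} -> R[i]}.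

Record conf (R : realType) := Conf {
  conf_qv : {fset nat};
  conf_reg : hilb R conf_qv;
  conf_term : term }.

Definition well_formed (R : realType) (C : conf R) : Prop :=
  {subset qvars (conf_term C) <= conf_qv C} /\ exists G, wf G (conf_term C).

(** Value of an assignment at a name (junk value outside of its domain). *)
Definition lookup (QV : {fset nat}) (f : {ffun QV -> bool}) (r : nat) : bool :=
  if insub r is Some x then f x else false.

(** The assignment [f \o s] on [QV]; a restriction when [s = id]. *)
Definition pull (s : nat -> nat) (QV QV' : {fset nat})
    (f : {ffun QV' -> bool}) : {ffun QV -> bool} :=
  [ffun x : QV => lookup f (s (val x))].

(** Q (x) |r |-> c>. *)
Definition add_qubit (R : realType) (QV : {fset nat}) (r : nat) (c : bool)
    (Q : hilb R QV) : hilb R (r |` QV)%fset :=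
  [ffun f : {ffun (r |` QV)%fset -> bool} =>
     if lookup f r == c then Q (pull id QV f) else 0%R].

(** U_<<r_1,...,r_n>> Q : [U] on the qubits [rs], identity on the others. *)
Definition apply_op (R : realType) (QV : {fset nat}) n (U : 'M[R[i]]_(2 ^ n))
    (rs : n.-tuple nat) (Q : hilb R QV) : hilb R QV :=
  [ffun f : {ffun QV -> bool} =>
     (\sum_(g : {ffun QV -> bool} |
            [forall x : QV, (val x \notin rs) ==> (g x == f x)])
        U (basis_index (map_tuple (lookup f) rs))
          (basis_index (map_tuple (lookup g) rs)) * Q g)%R].

(** Every bijection between finite sets of names extends to a permutation. *)
Definition conf_equiv (R : realType) (C D : conf R) : Prop :=
  exists s : nat -> nat,
    [/\ bijective s, conf_qv D = [fset s r | r in conf_qv C]%fset,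
        conf_term D = rename_q s (conf_term C)
      & forall f, conf_reg D f = conf_reg C (pull s (conf_qv C) f)].

(** <r_1,...,r_n>, where the "1-tuple" <r>, the argument of a one-qubit
   operator, is r itself. *)
Definition qtuple (rs : seq nat) : term :=
  if rs is [:: r] then QVar r else Tup (map QVar rs).

(** Surface reduction, on representatives: every constructor but ! is a
   congruence.  The closure under New and LamBang is essential: without it,
   with W = \!x.x!x, the term (\x.new(x))(W!W) would reduce to the normal form
   new(W!W), and also to itself. *)
Inductive red (R : realType) (G : gates R) : conf R -> conf R -> Prop :=
| red_lbeta QV (Q : hilb R QV) M N :
    red G (Conf Q (App (LamPat SVar M) N)) (Conf Q (inst 0 [:: N] M))
| red_qbeta QV (Q : hilb R QV) M rs :
    red G (Conf Q (App (LamPat (STup (size rs)) M) (Tup (map QVar rs))))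
          (Conf Q (inst 0 (map QVar rs) M))
| red_cbeta QV (Q : hilb R QV) M N :
    red G (Conf Q (App (LamBang M) (Bang N))) (Conf Q (inst 0 [:: N] M))
| red_uq QV (Q : hilb R QV) i (rs : (arity G i).-tuple nat) :
    red G (Conf Q (App (Gate i) (qtuple rs)))
          (Conf (apply_op (op G i) rs Q) (qtuple rs))
| red_new QV (Q : hilb R QV) r c :
    r \notin QV -> red G (Conf Q (New (Bit c))) (Conf (add_qubit r c Q) (QVar r))
| red_lcm QV (Q : hilb R QV) p L M N :
    red G (Conf Q (App L (App (LamPat p M) N)))
          (Conf Q (App (LamPat p (App (lift_term 0 L) M)) N))
| red_rcm QV (Q : hilb R QV) p L M N :
    red G (Conf Q (App (App (LamPat p M) N) L))
          (Conf Q (App (LamPat p (App M (lift_term 0 L))) N))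
| red_tuple QV QV' (Q : hilb R QV) (Q' : hilb R QV') M M' Ms Ns :
    red G (Conf Q M) (Conf Q' M') ->
    red G (Conf Q (Tup (Ms ++ M :: Ns))) (Conf Q' (Tup (Ms ++ M' :: Ns)))
| red_app_l QV QV' (Q : hilb R QV) (Q' : hilb R QV') M M' N :
    red G (Conf Q M) (Conf Q' M') ->
    red G (Conf Q (App M N)) (Conf Q' (App M' N))
| red_app_r QV QV' (Q : hilb R QV) (Q' : hilb R QV') M N N' :
    red G (Conf Q N) (Conf Q' N') ->
    red G (Conf Q (App M N)) (Conf Q' (App M N'))
| red_new_in QV QV' (Q : hilb R QV) (Q' : hilb R QV') M M' :
    red G (Conf Q M) (Conf Q' M') -> red G (Conf Q (New M)) (Conf Q' (New M'))
| red_lam_bang QV QV' (Q : hilb R QV) (Q' : hilb R QV') M M' :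
    red G (Conf Q M) (Conf Q' M') ->
    red G (Conf Q (LamBang M)) (Conf Q' (LamBang M'))
| red_lam_pat QV QV' (Q : hilb R QV) (Q' : hilb R QV') p M M' :
    red G (Conf Q M) (Conf Q' M') ->
    red G (Conf Q (LamPat p M)) (Conf Q' (LamPat p M')).

(** Reduction of configurations modulo renaming of quantum variables. *)
Definition step (R : realType) (G : gates R) (C D : conf R) : Prop :=
  exists C' D', [/\ conf_equiv C C', red G C' D' & conf_equiv D' D].

Definition normal_form (R : realType) (G : gates R) (C : conf R) : Prop :=
  ~ exists D, step G C D.

Definition strongly_normalizing (R : realType) (G : gates R) (C : conf R) :=
  ~ exists s : nat -> conf R, s 0 = C /\ forall i, step G (s i) (s i.+1).

Definition weakly_normalizing (R : realType) (G : gates R) (C : conf R) :=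
  exists D, clos_refl_trans _ (step G) C D /\ normal_form G D.

(* Main.v *)
From HB Require Import structures.
From Stdlib Require Import List Permutation Relation_Operators.
From mathcomp Require Import all_boot zify.
From mathcomp Require Import finmap boolp.
Require Import Defs.
From mathcomp Require Import reals.

Set Implicit Arguments.
Unset Strict Implicit.
Unset Printing Implicit Defensive.

(** The calculus is not confluent: [(\x.<x,y>) ((\pi.M) N)] has a critical
    pair that need not be joinable when [N] is stuck.  Instead of a diamond
    property, the proof uses a non-idempotent intersection type system that is
    blind to the commutations of [(\pi.M) N] with its context.  A derivation
    carries a cost, the number of applications and [new]s in it.  A step
    preserves and reflects typability; it lowers the cost by one, or is a
    commutation, which keeps the cost and lowers a product interpretation of
    terms.  Hence typable terms are strongly normalizing.  Normal forms are
    typable with all their variables inert, so that weakly normalizing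
    terms are typable as well. *)

(** A step that could discard a diverging subterm would break the theorem. None does: a linear
    variable occurs exactly once and outside every [!], and what [\!x] erases or copies is the
    content of a [!], where no reduction takes place. For the same reason typability is reflected as
    well as preserved: a linear redex moves one derivation of its argument, and a [!] carries one
    derivation of its content per use, none if it is erased. The counting of occurrences,
    [linear_term], is the invariant extracted from well-formedness. The blindness to commutations
    comes from giving [(\p.M) N] the type of [M]: moving [L] under the abstraction changes neither
    the number of applications nor the uses. The other obstacle is stuck terms: a normal form may
    apply a gate or a variable, or apply [\!x.M] to something that is not a [!]. The type [TInert]
    and the second cases of [app_ty] and [abs_ty] are there for them. *)

Lemma term_nested_ind (P : term -> Prop) :
  (forall x, P (FVar x)) -> (forall k i, P (BVar k i)) ->
  (forall r, P (QVar r)) -> (forall M, P M -> P (Bang M)) ->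
  (forall b, P (Bit b)) -> (forall i, P (Gate i)) ->
  (forall M, P M -> P (New M)) ->
  (forall M N, P M -> P N -> P (App M N)) ->
  (forall Ms, (forall M, List.In M Ms -> P M) -> P (Tup Ms)) ->
  (forall M, P M -> P (LamBang M)) ->
  (forall p M, P M -> P (LamPat p M)) ->
  forall M, P M.
Proof.
move=> hf hb hq hbang hbit hg hn ha ht hlb hlp.
fix IH 1; case.
- exact: hf.
- exact: hb.
- exact: hq.
- by move=> M; apply: hbang.
- exact: hbit.
- exact: hg.
- by move=> M; apply: hn.
- by move=> M N; apply: ha.
- move=> Ms; apply: ht; elim: Ms => [|N Ns IHs] M /=; first by case.
  by case=> [<-|]; [apply: IH | apply: IHs].
- by move=> M; apply: hlb.
- by move=> p M; apply: hlp.
Qed.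

(** * Linearity *)

(* An occurrence inside [!] counts double, so that [occ k i M = 1] says that
   the variable occurs exactly once, and not inside a [!]. *)
Fixpoint occ (k i : nat) (M : term) : nat :=
  match M with
  | BVar l j => (k == l) && (i == j)
  | Bang M => (occ k i M).*2
  | New M => occ k i M
  | App M N => occ k i M + occ k i N
  | Tup Ms => sumn (map (occ k i) Ms)
  | LamBang M | LamPat _ M => occ k.+1 i M
  | FVar _ | QVar _ | Bit _ | Gate _ => 0
  end.

Definition shape_size (p : shape) : nat := if p is STup n then n else 1.

(** Indices are components of the bound pattern: [\!x] has the sole index 0, used at will, while
    each component of a linear pattern is used once, outside every [!]. *)
Fixpoint linear_term (M : term) : Prop :=
  match M with
  | Bang M | New M => linear_term M
  | App M N => linear_term M /\ linear_term N
  | Tup Ms => foldr (fun M P => linear_term M /\ P) True Ms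
  | LamBang M => linear_term M /\ forall i, 0 < i -> occ 0 i M = 0
  | LamPat p M => linear_term M /\ forall i, occ 0 i M = (i < shape_size p)
  | FVar _ | BVar _ _ | QVar _ | Bit _ | Gate _ => True
  end.

Lemma linear_tuple Ms :
  linear_term (Tup Ms) <-> forall M, List.In M Ms -> linear_term M.
Proof.
elim: Ms => [|M Ms IH] /=; first by split.
split=> [[lM /IH lMs] N [<-|/lMs]//|lMs].
by split; [apply: lMs; left | apply/IH => N HN; apply: lMs; right].
Qed.

Lemma occ_lift_bump c k i M : occ (bump c k) i (lift_term c M) = occ k i M.
Proof.
elim/term_nested_ind: M c k => //=.
- move=> l j c k; case: ltnP => Hl /=; congr (nat_of_bool (_ && _)); rewrite /bump; lia.
- by move=> M IH c k; rewrite IH.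
- by move=> M N IH1 IH2 c k; rewrite IH1 IH2.
- move=> Ms IH c k; rewrite -map_comp; congr sumn.
  by apply: List.map_ext_in => M /IH /= ->.
- by move=> M IH c k; rewrite -bumpS IH.
- by move=> p M IH c k; rewrite -bumpS IH.
Qed.

Lemma occ_lift_eq0 c i M : occ c i (lift_term c M) = 0.
Proof.
elim/term_nested_ind: M c => //=.
- by move=> l j c; case: ltnP => Hl /=; case: eqP => //=; lia.
- by move=> M IH c; rewrite IH.
- by move=> M N IH1 IH2 c; rewrite IH1 IH2.
- move=> Ms IH c; elim: Ms IH => //= M Ms IHs IH.
  by rewrite IH; [apply: IHs => N HN; apply: IH; right | left].
Qed.

Lemma nth_lift c Ns j :
  nth (Bit false) (map (lift_term c) Ns) j = lift_term c (nth (Bit false) Ns j).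
Proof. by elim: Ns j => [|N Ns IH] [|j] //=. Qed.

(** [bump c k] is the level that [k] had before the binder [c] disappeared. An index beyond [Ns]
    yields [Bit false], which holds no reference, so the sum stops at [size Ns]. *)
Lemma occ_inst c k i Ns M :
  occ k i (inst c Ns M) =
  occ (bump c k) i M
  + \sum_(j < size Ns) occ c j M * occ k i (nth (Bit false) Ns j).
Proof.
elim/term_nested_ind: M c k Ns => //=; try by move=> *; rewrite big1.
- move=> l j c k Ns; case: ltngtP => [Hl|Hl|<-] /=.
  + rewrite big1 => [|j' _]; last by case: (c =P l) => [|] //=; lia.
    by rewrite addn0; congr (nat_of_bool (_ && _)); rewrite /bump; lia.
  + rewrite big1 => [|j' _]; last by case: (c =P l) => [|] //=; lia.
    by rewrite addn0; congr (nat_of_bool (_ && _)); rewrite /bump; lia.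
  + have -> : (bump l k == l) = false by apply/negbTE; rewrite /bump; lia.
    rewrite /=; case: (ltnP j (size Ns)) => Hj.
      rewrite (bigD1 (Ordinal Hj)) //= eqxx mul1n big1 ?addn0 // => j'.
      by rewrite -val_eqE /= => /negbTE ->.
    rewrite nth_default //= big1 // => j' _.
    by case: (j' =P j :> nat) => [E|] //=; move: (ltn_ord j'); rewrite E; lia.
- move=> M IH c k Ns; rewrite IH doubleD; congr (_ + _).
  by rewrite -mul2n big_distrr /=; apply: eq_bigr => j _; lia.
- move=> M N IH1 IH2 c k Ns; rewrite IH1 IH2 addnACA -big_split /=.
  by congr (_ + _); apply: eq_bigr => j _; rewrite mulnDl.
- move=> Ms IH c k Ns; elim: Ms IH => [|M Ms IHs] IH /=; first by rewrite big1.
  rewrite IH; last by left.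
  rewrite IHs => [|N HN]; last by apply: IH; right.
  rewrite addnACA -big_split /=.
  by congr (_ + _); apply: eq_bigr => j _; rewrite mulnDl.
- move=> M IH c k Ns; rewrite IH bumpS size_map; congr (_ + _).
  apply: eq_bigr => j _.
  by rewrite nth_lift -(occ_lift_bump 0 k).
- move=> p M IH c k Ns; rewrite IH bumpS size_map; congr (_ + _).
  apply: eq_bigr => j _.
  by rewrite nth_lift -(occ_lift_bump 0 k).
Qed.

Lemma linear_lift c M : linear_term M -> linear_term (lift_term c M).
Proof.
elim/term_nested_ind: M c => //=.
- by move=> k i c _; case: ifP.
- by move=> M N IH1 IH2 c [/(IH1 c) ? /(IH2 c) ?].
- move=> Ms IH c /linear_tuple lMs; apply/(linear_tuple (map _ _)) => M.
  by case/List.in_map_iff => N [<- HN]; apply: IH => //; apply: lMs.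
- move=> M IH c [lM o]; split; first exact: IH.
  by move=> i i0; rewrite (occ_lift_bump c.+1 0) o.
- move=> p M IH c [lM o]; split; first exact: IH.
  by move=> i; rewrite (occ_lift_bump c.+1 0) o.
Qed.

Lemma occ_inst_under c i Ns M :
  occ 0 i (inst c.+1 (map (lift_term 0) Ns) M) = occ 0 i M.
Proof.
rewrite occ_inst /= big1 ?addn0 // => j _.
by rewrite nth_lift occ_lift_eq0 muln0.
Qed.

Lemma linear_inst c Ns M :
  linear_term M -> (forall N, List.In N Ns -> linear_term N) ->
  linear_term (inst c Ns M).
Proof.
have up Ns' : (forall N, List.In N Ns' -> linear_term N) ->
    forall N, List.In N (map (lift_term 0) Ns') -> linear_term N.
  by move=> lNs N /List.in_map_iff [N' [<- /lNs]]; apply: linear_lift.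
elim/term_nested_ind: M c Ns => //=.
- move=> k i c Ns _ lNs; case: ifP => // _; case: ifP => // _.
  elim: Ns i lNs => [|N Ns IH] [|i] lNs //=; first by apply: lNs; left.
  by apply: IH => N' HN'; apply: lNs; right.
- by move=> M N IH1 IH2 c Ns [l1 l2] lNs; split; [apply: IH1 | apply: IH2].
- move=> Ms IH c Ns /linear_tuple lMs lNs; apply/(linear_tuple (map _ _)) => M.
  by case/List.in_map_iff => N [<- HN]; apply: IH => //; apply: lMs.
- move=> M IH c Ns [lM o] lNs; split; first by apply: IH => //; apply: up.
  by move=> i; rewrite occ_inst_under; apply: o.
- move=> p M IH c Ns [lM o] lNs; split; first by apply: IH => //; apply: up.
  by move=> i; rewrite occ_inst_under; apply: o.
Qed.

Lemma occ_rename_q s k i M : occ k i (rename_q s M) = occ k i M.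
Proof.
elim/term_nested_ind: M k => //=.
- by move=> M IH k; rewrite IH.
- by move=> M N IH1 IH2 k; rewrite IH1 IH2.
- move=> Ms IH k; rewrite -map_comp; congr sumn.
  by apply: List.map_ext_in => M /IH /= ->.
Qed.

Lemma linear_rename_q s M : linear_term (rename_q s M) <-> linear_term M.
Proof.
elim/term_nested_ind: M => //=.
- by move=> M N IH1 IH2; rewrite IH1 IH2.
- by move=> Ms; elim: Ms => //= M Ms IHs IH; rewrite IH ?IHs //; auto.
- by move=> M IH; rewrite IH; split=> -[? o]; split=> // i; move: (o i); rewrite occ_rename_q.
- by move=> p M IH; rewrite IH; split=> -[? o]; split=> // i; move: (o i); rewrite occ_rename_q.
Qed.

(** A [\!x] redex may copy or erase a content, but occurrences there count double, so the bound 1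
    forces them to be 0. Every condition on bound variables in [linear_term] meets this bound, hence
    survives a step under the binder. *)
Lemma red_occ (R : realType) (G : gates R) C D :
  red G C D -> linear_term (conf_term C) ->
  forall k i, occ k i (conf_term C) <= 1 ->
  occ k i (conf_term D) = occ k i (conf_term C).
Proof.
elim=> {C D} /=.
- move=> QV Q M N [[_ o] _] k i _.
  by rewrite occ_inst /= big_ord_recl big_ord0 /= o mul1n addn0.
- move=> QV Q M rs [[_ o] _] k i _.
  have o0 j : occ k i (nth (Bit false) (map QVar rs) j) = 0.
    by elim: rs j {o} => [|r rs IH] [|j] //=.
  rewrite occ_inst /= big1 => [|j _]; last by rewrite o0 muln0.
  rewrite addn0 (_ : sumn _ = 0) ?addn0 //.
  by elim: rs {o o0} => [|r rs] //=.
- move=> QV Q M N _ k i; rewrite occ_inst /= big_ord_recl big_ord0 /= addn0.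
  by case: (occ k i N) => [|n]; rewrite ?muln0 //; lia.
- move=> QV Q j rs _ k i _; by rewrite add0n.
- by [].
- by move=> QV Q p L M N _ k i _; rewrite (occ_lift_bump 0 k); lia.
- by move=> QV Q p L M N _ k i _; rewrite (occ_lift_bump 0 k); lia.
- move=> QV QV' Q Q' M M' Ms Ns _ IH /(linear_tuple (_ ++ _)) lMs k i.
  rewrite !map_cat !sumn_cat /= => o; rewrite IH //; last by lia.
  by apply: lMs; apply/List.in_app_iff; right; left.
- by move=> QV QV' Q Q' M M' N _ IH [l1 l2] k i o; rewrite IH //; lia.
- by move=> QV QV' Q Q' M N N' _ IH [l1 l2] k i o; rewrite IH //; lia.
- by move=> QV QV' Q Q' M M' _ IH l k i o; rewrite IH.
- by move=> QV QV' Q Q' M M' _ IH [l _] k i o; rewrite IH.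
- by move=> QV QV' Q Q' p M M' _ IH [l _] k i o; rewrite IH.
Qed.

Lemma red_linear (R : realType) (G : gates R) C D :
  red G C D -> linear_term (conf_term C) -> linear_term (conf_term D).
Proof.
elim=> {C D} /=.
- by move=> QV Q M N [[lM _] lN]; apply: linear_inst => // N' [<-|].
- move=> QV Q M rs [[lM _] _]; apply: linear_inst => // N.
  by case/List.in_map_iff => r [<- _].
- by move=> QV Q M N [[lM _] lN]; apply: linear_inst => // N' [<-|].
- by move=> QV Q j rs [].
- by [].
- move=> QV Q p L M N [lL [[lM o] lN]]; split=> //.
  split; first by split=> //; apply: linear_lift.
  by move=> i; rewrite occ_lift_eq0 add0n.
- move=> QV Q p L M N [[[lM o] lN] lL]; split=> //.
  split; first by split=> //; apply: linear_lift.
  by move=> i; rewrite occ_lift_eq0 addn0.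
- move=> QV QV' Q Q' M M' Ms Ns _ IH /(linear_tuple (_ ++ _)) lMs.
  apply/(linear_tuple (_ ++ _)) => N /List.in_app_iff [HN|[<-|HN]].
  + by apply: lMs; apply/List.in_app_iff; left.
  + by apply: IH; apply: lMs; apply/List.in_app_iff; right; left.
  + by apply: lMs; apply/List.in_app_iff; right; right.
- by move=> QV QV' Q Q' M M' N _ IH [/IH].
- by move=> QV QV' Q Q' M N N' _ IH [? /IH].
- by [].
- move=> QV QV' Q Q' M M' r IH [lM o]; split; first exact: IH.
  by move=> i i0; have /= := red_occ r lM (k := 0) (i := i); rewrite o // => ->.
- move=> QV QV' Q Q' p M M' r IH [lM o]; split; first exact: IH.
  by move=> i; have /= := red_occ r lM (k := 0) (i := i); rewrite o => -> //; apply: leq_b1.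
Qed.

(** * Linearity of well-formed terms *)

Fixpoint focc (x : nat) (M : term) : nat :=
  match M with
  | FVar y => x == y
  | Bang M => (focc x M).*2
  | New M | LamBang M | LamPat _ M => focc x M
  | App M N => focc x M + focc x N
  | Tup Ms => sumn (map (focc x) Ms)
  | BVar _ _ | QVar _ | Bit _ | Gate _ => 0
  end.

Definition linear_names (G : env) : seq nat :=
  flatten [seq if e is EPat p then pat_vars p else [::] | e <- G].

Definition bang_names (G : env) : seq nat :=
  pmap (fun e => if e is EBang x then Some x else None) G.

Lemma linear_names_cat G1 G2 :
  linear_names (G1 ++ G2) = linear_names G1 ++ linear_names G2.
Proof. by rewrite /linear_names map_cat flatten_cat. Qed.

Lemma bang_names_cat G1 G2 :
  bang_names (G1 ++ G2) = bang_names G1 ++ bang_names G2.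
Proof. by rewrite /bang_names pmap_cat. Qed.

(** Sealed against simplification, so that [/=] leaves the counts as atoms for [lia]. *)
Definition mult (x : nat) (s : seq nat) : nat := count_mem x s.
Arguments mult : simpl never.

Lemma mult_cat x s1 s2 : mult x (s1 ++ s2) = mult x s1 + mult x s2.
Proof. exact: count_cat. Qed.

Lemma mult_cons x y s : mult x (y :: s) = (y == x) + mult x s.
Proof. by []. Qed.

Lemma mult_uniq x s : uniq s -> mult x s = (x \in s).
Proof. by move=> us; apply: count_uniq_mem. Qed.

Lemma mult_cnames x G :
  mult x (cnames G) =
  mult x (linear_names G) + mult x (bang_names G).
Proof.
rewrite /cnames /linear_names /bang_names.
by elim: G => //= -[p|y|r] G IH /=; rewrite ?mult_cat ?mult_cons /= ?mult_cons ?mult_cat IH; lia.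
Qed.

Lemma mult_names_perm x G D : Permutation G D ->
  mult x (linear_names G) = mult x (linear_names D) /\
  mult x (bang_names G) = mult x (bang_names D).
Proof.
have lin e H : mult x (linear_names (e :: H)) =
    mult x (linear_names [:: e]) + mult x (linear_names H).
  by rewrite -mult_cat -linear_names_cat.
have bang e H : mult x (bang_names (e :: H)) =
    mult x (bang_names [:: e]) + mult x (bang_names H).
  by rewrite -mult_cat -bang_names_cat.
elim=> {G D} //.
- by move=> e G D _ [IH1 IH2]; rewrite lin (lin e D) bang (bang e D) IH1 IH2.
- move=> e1 e2 G; rewrite (lin e2) (lin e1 G) (lin e1 (e2 :: G)) (lin e2 G).
  by rewrite (bang e2) (bang e1 G) (bang e1 (e2 :: G)) (bang e2 G); lia.
- by move=> G D E _ [-> ->] _ [-> ->].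
Qed.

Lemma occ_close c xs k i M : uniq xs ->
  occ k i (close c xs M) =
  occ k i M + ((k == c) && (i < size xs)) * focc (nth 0 xs i) M.
Proof.
move=> xs_uniq; elim/term_nested_ind: M c k => //=; try by move=> *; lia.
- move=> x c k; case: ifP => xs_x /=; last first.
    case: (ltnP i (size xs)) => Hi; last by rewrite andbF.
    rewrite andbT; case: (nth 0 xs i =P x) => [E|_]; last by rewrite muln0.
    by move: xs_x; rewrite -E mem_nth.
  case: (k =P c) => //= _; rewrite add0n.
  case: (ltnP i (size xs)) => Hi; last first.
    by case: (i =P index x xs) => // E; move: xs_x; rewrite -index_mem -E; lia.
  rewrite mul1n; congr nat_of_bool.
  apply/eqP/eqP => [->|<-]; first exact: nth_index.
  by rewrite index_uniq.
- by move=> M IH c k; rewrite IH; lia.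
- by move=> M N IH1 IH2 c k; rewrite IH1 IH2; lia.
- move=> Ms IH c k; elim: Ms IH => [|M Ms IHs] IH /=; first by lia.
  rewrite IH; last by left.
  by rewrite IHs => [|N HN]; [lia | apply: IH; right].
- by move=> M IH c k; rewrite IH.
- by move=> p M IH c k; rewrite IH.
Qed.

Lemma focc_close c xs x M :
  focc x (close c xs M) = if x \in xs then 0 else focc x M.
Proof.
elim/term_nested_ind: M c => //=; try by move=> *; case: ifP.
- move=> y c; case: (x =P y) => [<-|/eqP/negbTE xy].
    by case: ifP => //= _; rewrite eqxx.
  by case: ifP; case: ifP => //= _ _; rewrite xy.
- by move=> M IH c; rewrite IH; case: ifP.
- by move=> M N IH1 IH2 c; rewrite IH1 IH2; case: ifP.
- move=> Ms IH c; elim: Ms IH => [|M Ms IHs] IH /=; first by case: ifP.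
  rewrite IH; last by left.
  by rewrite IHs => [|N HN]; [case: ifP | apply: IH; right].
Qed.

Lemma linear_close c xs M : uniq xs -> linear_term M -> linear_term (close c xs M).
Proof.
move=> xs_uniq; elim/term_nested_ind: M c => //=.
- by move=> x c; case: ifP.
- by move=> M N IH1 IH2 c [/(IH1 c) ? /(IH2 c) ?].
- move=> Ms IH c /linear_tuple lMs; apply/(linear_tuple (map _ _)) => M.
  by case/List.in_map_iff => N [<- HN]; apply: IH => //; apply: lMs.
- move=> M IH c [lM o]; split; first exact: IH.
  by move=> i i0; rewrite occ_close //= o.
- move=> p M IH c [lM o]; split; first exact: IH.
  by move=> i; rewrite occ_close //= o addn0.
Qed.

Lemma occ_rename_c s k i M : occ k i (rename_c s M) = occ k i M.
Proof.
elim/term_nested_ind: M k => //=.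
- by move=> M IH k; rewrite IH.
- by move=> M N IH1 IH2 k; rewrite IH1 IH2.
- move=> Ms IH k; rewrite -map_comp; congr sumn.
  by apply: List.map_ext_in => M /IH /= ->.
Qed.

Lemma linear_rename_c s M : linear_term M -> linear_term (rename_c s M).
Proof.
elim/term_nested_ind: M => //=.
- by move=> M N IH1 IH2 [/IH1 ? /IH2 ?].
- by move=> Ms; elim: Ms => //= M Ms IHs IH [l ls]; split; auto.
- by move=> M IH [/IH l o]; split=> // i; move: (o i); rewrite occ_rename_c.
- by move=> p M IH [/IH l o]; split=> // i; move: (o i); rewrite occ_rename_c.
Qed.

Lemma focc_contract x y z w M : w != z ->
  focc w (rename_c (fun v => if (v == x) || (v == y) then z else v) M) =
  if (w == x) || (w == y) then 0 else focc w M.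
Proof.
move=> w_z; elim/term_nested_ind: M => //=; try by move=> *; case: ifP.
- move=> v; case: (w =P v) => [<-|/eqP/negbTE w_v]; case: ifP => // _.
  + by rewrite (negbTE w_z).
  + by rewrite eqxx.
  + by rewrite (negbTE w_z); case: ifP.
  + by rewrite w_v; case: ifP.
- by move=> M ->; case: ifP.
- by move=> M N -> ->; case: ifP.
- move=> Ms IH; elim: Ms IH => [|M Ms IHs] IH /=; first by case: ifP.
  rewrite IH; last by left.
  by rewrite IHs => [|N HN]; [case: ifP | apply: IH; right].
Qed.

(** A name declared with [!] may occur at will, so nothing is said of it; any other name occurs as
    often as it is declared, in particular not at all if it is undeclared. *)
Definition occ_spec (G : env) (M : term) : Prop :=
  [/\ forall k i, occ k i M = 0, linear_term M
    & forall x : nat, mult x (bang_names G) = 0 ->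
                focc x M = mult x (linear_names G)].

Lemma occ_spec_tuple Gs Ms : size Gs = size Ms ->
  (forall i, i < size Ms -> occ_spec (nth [::] Gs i) (nth (Bit false) Ms i)) ->
  occ_spec (flatten Gs) (Tup Ms).
Proof.
elim: Ms Gs => [|M Ms IH] [|G Gs] //= [E] H.
have /= [o1 l1 f1] := H 0 isT.
have [o2 l2 f2] := IH Gs E (fun i Hi => H i.+1 Hi).
split=> //= [k i|x]; first by rewrite o1 -[RHS](o2 k i).
rewrite bang_names_cat linear_names_cat !mult_cat => Hx.
by have /= h2 := f2 x; rewrite f1 ?h2 //; lia.
Qed.

(** Uniqueness of names belongs to the induction: it gives a linear name multiplicity 1 and keeps it
    out of [bang_names], so that abstracting it binds exactly one occurrence. *)
Lemma wf_occ_spec G M : wf G M -> uniq (cnames G) /\ occ_spec G M.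
Proof.
elim=> {G M}.
- move=> G D M GD _ [uG [o l f]]; split.
    rewrite -(@perm_uniq _ (cnames G)) //; apply/allP => x _ /=; apply/eqP.
    rewrite -!/(mult x _) !mult_cnames.
    by case: (mult_names_perm x GD) => -> ->.
  split=> // x.
  by case: (mult_names_perm x GD) => <- <-; apply: f.
- by [].
- by [].
- by [].
- by move=> x; split=> //; split=> //= y _; rewrite mult_cons eq_sym addn0.
- move=> G x M _ [_ [o l f]] /andP [u _]; split=> //; split=> // y /=.
  by rewrite mult_cons => Hy; rewrite f //; lia.
- move=> G x y z M _ [uG [o l f]] /andP [u _]; split=> //; split.
  + by move=> k i; rewrite occ_rename_c.
  + exact: linear_rename_c.
  + move=> w /=; rewrite mult_cons => Hw.
    rewrite focc_contract; last by rewrite eq_sym; lia.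
    (* The renaming removes [x] and [y]; being unique in the environment of the premise, they have
       no linear declaration in [G] either. *)
    have := mult_uniq w uG; rewrite /cnames /= -/(cnames G) !mult_cons.
    rewrite mult_cnames -/(linear_names G); move: (f w).
    rewrite /= !mult_cons !(eq_sym w) => fw.
    case: ifP fw => xy fw E; last by rewrite fw //; lia.
    by move: E; case: (_ \in _); rewrite /linear_names /=; lia.
- move=> G M aG _ [uG [o l f]]; split=> //; split=> //= [k i|x Hx].
    by rewrite o.
  by rewrite f //; elim: G aG {uG f Hx} => [|[]] //=.
- move=> G x M _ [uG [o l f]]; split=> //; split=> // y /=; rewrite mult_cons => Hy.
  by rewrite f /= /linear_names /= ?mult_cons; lia.
- move=> G xs M _ _; rewrite /occ_spec.
  have -> : cnames (map (fun x => EPat (PVar x)) xs ++ G) = cnames (EPat (PTup xs) :: G).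
    by elim: xs => //= x xs; rewrite /cnames /= => ->.
  have -> : linear_names (map (fun x => EPat (PVar x)) xs ++ G)
            = linear_names (EPat (PTup xs) :: G).
    by elim: xs => //= x xs; rewrite /linear_names /= => ->.
  by have -> : bang_names (map (fun x => EPat (PVar x)) xs ++ G)
            = bang_names (EPat (PTup xs) :: G) by elim: xs.
- move=> Gs Ms _ E _ IH /andP [u _]; split=> //.
  by apply: occ_spec_tuple => // i /IH [].
- by [].
- move=> G p M _ [uG [o l f]].
  have [up _ uG'] : [/\ uniq (pat_vars p), ~~ has (mem (pat_vars p)) (cnames G) & uniq (cnames G)].
    by apply/and3P; rewrite -cat_uniq.
  have cp x : mult x (pat_vars p) + mult x (cnames G) <= 1.
    by rewrite -mult_cat (mult_uniq x uG) leq_b1.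
  have lp : linear_names (EPat p :: G) = pat_vars p ++ linear_names G by [].
  split=> //; split.
  + by move=> k i; rewrite /= occ_close // o.
  + split; first exact: linear_close.
    move=> i; rewrite occ_close // o eqxx /= add0n.
    have -> : shape_size (pat_shape p) = size (pat_vars p) by case: p {uG f up cp lp}.
    case: ltnP => Hi; last by rewrite mul0n.
    rewrite mul1n.
    have c1 : mult (nth 0 (pat_vars p) i) (pat_vars p) = 1.
      by rewrite mult_uniq // mem_nth.
    have := cp (nth 0 (pat_vars p) i); rewrite mult_cnames c1 => cp'.
    by rewrite f ?lp ?mult_cat ?c1 /=; lia.
  + move=> x /= Hx; rewrite focc_close; move: (cp x); rewrite mult_cnames Hx addn0.
    rewrite (mult_uniq x up); case: ifP => // xp; first by lia.
    by rewrite f // lp mult_cat (mult_uniq x up) xp.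
- move=> G x M _ [/= /andP [xG uG] [o l f]].
  split=> //; split.
  + by move=> k i; rewrite /= occ_close // o.
  + split; first exact: linear_close.
    by move=> [|i] // _; rewrite occ_close // o.
  + move=> y /= Hy; rewrite focc_close inE; case: eqP => [->|/eqP yx].
      have := mult_cnames x G; rewrite mult_uniq // -/(cnames G) (negbTE xG).
      by lia.
    by rewrite f //= mult_cons Hy eq_sym (negbTE yx).
- move=> G1 G2 M1 M2 _ [u1 [o1 l1 f1]] _ [u2 [o2 l2 f2]] /andP [u _]; split=> //.
  split=> //= [k i|x]; first by rewrite o1 o2.
  rewrite bang_names_cat linear_names_cat !mult_cat => Hx.
  by rewrite f1 ?f2 //; lia.
Qed.

Lemma well_formed_linear (R : realType) (C : conf R) :
  well_formed C -> linear_term (conf_term C).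
Proof. by case=> _ [G /wf_occ_spec [_ []]]. Qed.

(** * Non-idempotent intersection types *)

(* [TInert] types whatever is neither a function nor a [!]; [TBang m] is the
   intersection of the types in [m], one for each use of the content. *)
Inductive ty := TInert | TBang of seq ty | TArr of ty & ty.

HB.instance Definition _ := gen_eqMixin ty.

Definition not_bang (A : ty) : bool := if A is TBang _ then false else true.
Definition not_arr (A : ty) : bool := if A is TArr _ _ then false else true.

(* A resource is either one unit of cost or one use, at type [A], of the free
   variable [BVar k i]. *)
Inductive resource := Cost | Use of nat & nat & ty.

HB.instance Definition _ := gen_eqMixin resource.

Definition under (t : resource) : resource :=
  if t is Use k i A then Use k.+1 i A else Cost.

(* The resources of a body [u] split into those of its abstraction, [outer u],
   and the uses of the variables that the latter binds, [inner u]. *)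
Definition outer (u : seq resource) : seq resource :=
  pmap (fun t => match t with
                 | Cost => Some Cost
                 | Use k.+1 i A => Some (Use k i A)
                 | Use 0 _ _ => None
                 end) u.

Definition inner (u : seq resource) : seq (nat * ty) :=
  pmap (fun t => if t is Use 0 i A then Some (i, A) else None) u.

(* [distr P s v]: the resources [v] can be distributed among the elements [x]
   of [s], each satisfying [P x] with its share. *)
Definition distr (T : Type) (P : T -> seq resource -> Prop) (s : seq T) :=
  foldr (fun x Q v => exists v1 v2, [/\ P x v1, Q v2 & perm_eq v (v1 ++ v2)])
        (fun v => v = [::]) s.

Definition arg_ty (p : shape) (B : ty) (l : seq (nat * ty)) : Prop :=
  match p with
  | SVar => perm_eq l [:: (0, B)]
  | STup n => all (fun x => x.2 == TInert) l
  end.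

(* The types of an abstraction with body of type [A].  The abstraction of a
   tuple pattern accepts any argument, since [(\<xs>.M) N] never discards [M];
   an abstraction [\!x.M] whose argument is of a type [B] that is not a [!] is
   stuck forever. *)
Definition abs_ty (p : option shape) (T A : ty) (l : seq (nat * ty)) : Prop :=
  match p with
  | Some p => exists2 B, T = TArr B A & arg_ty p B l
  | None => (exists2 m, T = TArr (TBang m) A & perm_eq l [seq (0, B) | B <- m])
            \/ exists2 B, T = TArr B TInert & not_bang B
  end.

(** Second case: a head without arrow type, such as a gate, never becomes an abstraction. The
    application is inert, but [typ] still types its argument and charges for it. *)
Definition app_ty (T B A : ty) : Prop := T = TArr B A \/ not_arr T /\ A = TInert.

(** The multiset [u] holds context and cost together, so one [perm_eq] transports both. Tuples may
    forget the types of their components, since only tuples of quantum variables, which are inert,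
    are ever opened. *)
Fixpoint typ (M : term) (u : seq resource) (A : ty) : Prop :=
  match M with
  | BVar k i => u = [:: Use k i A]
  | FVar _ | QVar _ | Bit _ | Gate _ => A = TInert /\ u = [::]
  | Bang M => exists2 m, A = TBang m & distr (fun B v => typ M v B) m u
  | New M => A = TInert /\ exists B v, typ M v B /\ perm_eq u (Cost :: v)
  | App M N => exists T B v1 v2,
      [/\ app_ty T B A, typ M v1 T, typ N v2 B & perm_eq u (Cost :: v1 ++ v2)]
  | Tup Ms => A = TInert /\ distr (fun M v => exists B, typ M v B) Ms u
  | LamBang M => exists w B,
      [/\ typ M w B, abs_ty None A B (inner w) & perm_eq u (outer w)]
  | LamPat p M => exists w B,
      [/\ typ M w B, abs_ty (Some p) A B (inner w) & perm_eq u (outer w)]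
  end.

(** Each [perm_eq] becomes a linear equation between counts of an arbitrary predicate. *)
Ltac perm_count :=
  let c := fresh "c" in
  apply/permP; intro c;
  repeat match goal with
    H : is_true (perm_eq _ _) |- _ => move/permP/(_ c): H end;
  rewrite /= ?(count_cat, count_nseq) /= ?(count_cat, count_nseq) /=; lia.

(** * Distribution of resources *)

Section Distr.
Variable (T : Type).
Implicit Types (P Q : T -> seq resource -> Prop) (s : seq T).

Lemma distr_perm P s u v : perm_eq u v -> distr P s u -> distr P s v.
Proof.
case: s => [|x s] /= uv; first by move=> E; move: uv; rewrite E perm_sym => /perm_nilP.
by case=> v1 [v2 [H1 H2 H3]]; exists v1, v2; split=> //; perm_count.
Qed.

Lemma distr_cat P s1 s2 v :
  distr P (s1 ++ s2) v <->
  exists v1 v2, [/\ distr P s1 v1, distr P s2 v2 & perm_eq v (v1 ++ v2)].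
Proof.
elim: s1 v => [|x s1 IH] v /=.
  split=> [H|[_ [v2 [-> H E]]]]; first by exists [::], v.
  by apply: distr_perm H; rewrite perm_sym.
split.
  case=> v1 [v2 [H1 /IH [v3 [v4 [H3 H4 E']]] E]].
  exists (v1 ++ v3), v4; split=> //; last by perm_count.
  by exists v1, v3.
case=> v1 [v2 [[v3 [v4 [H3 H4 E']]] H2 E]].
exists v3, (v4 ++ v2); split=> //; last by perm_count.
by apply/IH; exists v4, v2.
Qed.

Lemma distr_map (S : Type) P (f : S -> T) (s : seq S) v :
  distr P (map f s) v = distr (fun x => P (f x)) s v.
Proof.
elim: s v => //= x s IH v.
by apply: propext; split=> -[v1 [v2 [H1 H2 H3]]]; exists v1, v2;
  move: H2; rewrite IH.
Qed.

Lemma distr_iff P Q s v :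
  (forall x w, List.In x s -> (P x w <-> Q x w)) ->
  (distr P s v <-> distr Q s v).
Proof.
elim: s v => //= x s IH v H; split=> -[v1 [v2 [H1 H2 H3]]]; exists v1, v2; split=> //.
- by apply/H; [left|].
- by apply/(IH v2) => // y w Hy; apply: H; right.
- by apply/H; [left|].
- by apply/(IH v2) => // y w Hy; apply: H; right.
Qed.

End Distr.

Lemma distr_perm_index (T : eqType) (P : T -> seq resource -> Prop) s s' v :
  perm_eq s s' -> distr P s v -> distr P s' v.
Proof.
elim: s s' v => [|x s IH] s' v; first by rewrite perm_sym => /perm_nilP ->.
move=> E [v1 [v2 [H1 H2 H3]]].
have xs' : x \in s' by rewrite -(perm_mem E) mem_head.
case/splitPr: xs' E => a b E.
have E' : perm_eq s (a ++ b).
  by perm_count.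
have /distr_cat [w1 [w2 [K1 K2 K3]]] := IH _ _ E' H2.
apply/distr_cat; exists w1, (v1 ++ w2); split=> //; last by perm_count.
by exists v1, w2.
Qed.

(** Carries the substitution lemma through the intersection typing a [!] and through tuples, where
    several derivations share one list of resources. *)
Lemma distr_comp (T : Type) (P Q : T -> seq resource -> Prop) S s v :
  (forall x w, List.In x s -> (Q x w <-> exists2 u, P x u & distr S u w)) ->
  (distr Q s v <-> exists2 u, distr P s u & distr S u v).
Proof.
elim: s v => [|x s IH] v H /=.
  by split=> [->|[u -> //]]; exists [::].
have {}IH w := IH w (fun y w Hy => H y w (or_intror Hy)).
split.
  case=> v1 [v2 [/(H x v1 (or_introl erefl)) [u1 P1 S1] /IH [u2 P2 S2] E]].
  exists (u1 ++ u2); first by exists u1, u2.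
  by apply/distr_cat; exists v1, v2.
case=> u [u1 [u2 [P1 P2 /distr_perm_index E]]] /E /distr_cat [v1 [v2 [S1 S2 E']]].
exists v1, v2; split=> //; first by apply/(H x v1 (or_introl erefl)); exists u1.
by apply/IH; exists u2.
Qed.

Lemma abs_ty_perm p T A l l' : perm_eq l l' -> abs_ty p T A l -> abs_ty p T A l'.
Proof.
case: p => [[|n]|] ll' /=.
- by case=> B -> H; exists B => //=; rewrite perm_sym in ll'; apply: perm_trans H.
- by case=> B -> H; exists B => //=; rewrite -(perm_all _ ll').
- case=> [[m -> H]|]; last by right.
  by left; exists m => //; rewrite perm_sym in ll'; apply: perm_trans H.
Qed.

Lemma typ_perm M u v A : perm_eq u v -> typ M u A -> typ M v A.
Proof.
have nil : perm_eq u v -> u = [::] -> v = [::].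
  by move=> E Eu; move: E; rewrite Eu perm_sym => /perm_nilP.
case: M => /=; try by move=> x /nil E [? /E].
- by move=> k i E Eu; rewrite perm_sym Eu in E; apply: perm_small_eq E.
- by move=> M E [m Am H]; exists m => //; apply: distr_perm H.
- by move=> M E [? [B [w [H1 H2]]]]; split=> //; exists B, w; split=> //; perm_count.
- by move=> M N E [T [B [v1 [v2 [H1 H2 H3 H4]]]]]; exists T, B, v1, v2; split=> //; perm_count.
- by move=> Ms E [? H]; split=> //; apply: distr_perm H.
- by move=> M E [w [B [H1 H2 H3]]]; exists w, B; split=> //; perm_count.
- by move=> p M E [w [B [H1 H2 H3]]]; exists w, B; split=> //; perm_count.
Qed.

(** * Resources across a binder, and substitution *)

Lemma inner_perm u v : perm_eq u v -> perm_eq (inner u) (inner v).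
Proof. exact: perm_pmap. Qed.

Lemma outer_perm u v : perm_eq u v -> perm_eq (outer u) (outer v).
Proof. exact: perm_pmap. Qed.

Lemma inner_cat u v : inner (u ++ v) = inner u ++ inner v.
Proof. exact: pmap_cat. Qed.

Lemma outer_cat u v : outer (u ++ v) = outer u ++ outer v.
Proof. exact: pmap_cat. Qed.

Lemma inner_under u : inner (map under u) = [::].
Proof. by elim: u => //= -[]. Qed.

Lemma outer_under u : outer (map under u) = u.
Proof. by elim: u => //= -[|k i A] u /= IH; congr (_ :: _). Qed.

(* [F] is a family of maps on terms, acting on references only, and [next]
   tells how its parameter changes under a binder; [lift_term] and [inst] are
   such families. *)
Section Substitution.
Variables (X : Type) (next : X -> X) (F : X -> term -> term).

Definition replaces (x : X) (t : resource) (v : seq resource) : Prop :=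
  if t is Use k i A then typ (F x (BVar k i)) v A else v = [:: Cost].

Hypothesis F_FVar : forall x y, F x (FVar y) = FVar y.
Hypothesis F_QVar : forall x y, F x (QVar y) = QVar y.
Hypothesis F_Bit : forall x y, F x (Bit y) = Bit y.
Hypothesis F_Gate : forall x y, F x (Gate y) = Gate y.
Hypothesis F_Bang : forall x M, F x (Bang M) = Bang (F x M).
Hypothesis F_New : forall x M, F x (New M) = New (F x M).
Hypothesis F_App : forall x M N, F x (App M N) = App (F x M) (F x N).
Hypothesis F_Tup : forall x Ms, F x (Tup Ms) = Tup (map (F x) Ms).
Hypothesis F_LamBang : forall x M, F x (LamBang M) = LamBang (F (next x) M).
Hypothesis F_LamPat : forall x p M, F x (LamPat p M) = LamPat p (F (next x) M).
Hypothesis F_bound : forall x i, F (next x) (BVar 0 i) = BVar 0 i.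
Hypothesis F_free : forall x k i v A,
  typ (F (next x) (BVar k.+1 i)) v A <->
  exists2 w, typ (F x (BVar k i)) w A & perm_eq v (map under w).

(** A use of the bound variable is replaced by itself, and the image of any other use is shifted, so
    it adds nothing to [inner]. The next lemma goes the other way, by shifting the outside
    resources. *)
Lemma distr_replaces_outer x w v : distr (replaces (next x)) w v ->
  perm_eq (inner v) (inner w) /\ distr (replaces x) (outer w) (outer v).
Proof.
elim: w v => [|t w IH] v /=; first by move=> ->.
case=> v1 [v2 [H1 /IH [E1 H2] E]].
have /inner_perm := E; have /outer_perm := E; rewrite inner_cat outer_cat => Eo Ei.
case: t H1 => [|[|k] i A] /=.
- move=> Ev1; rewrite Ev1 /= in Eo Ei; split; first by perm_count.
  by exists [:: Cost], (outer v2).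
- rewrite F_bound /= => Ev1; rewrite Ev1 /= in Eo Ei; split; first by perm_count.
  by apply: distr_perm H2; rewrite perm_sym.
- case/F_free => v0 H0 Ev0; have /inner_perm := Ev0; have /outer_perm := Ev0.
  rewrite inner_under outer_under => Eo0 Ei0.
  split; first by perm_count.
  by exists v0, (outer v2); split=> //; perm_count.
Qed.

Lemma distr_replaces_body x w v : distr (replaces x) (outer w) v ->
  exists v', [/\ distr (replaces (next x)) w v', perm_eq (inner v') (inner w)
               & perm_eq v (outer v')].
Proof.
elim: w v => [|t w IH] v /=; first by move=> ->; exists [::].
case: t => [|[|k] i A] /=.
- case=> v1 [v2 [-> /IH [v' [H E1 E2]] E]]; exists (Cost :: v'); split=> //=.
    by exists [:: Cost], v'.
  by perm_count.
- case/IH=> v' [H E1 E2]; exists (Use 0 i A :: v'); split=> //=; last by rewrite perm_cons.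
  by exists [:: Use 0 i A], v'; split=> //; rewrite F_bound.
- case=> v1 [v2 [H1 /IH [v' [H E1 E2]] E]].
  exists (map under v1 ++ v'); split.
  + by exists (map under v1), v'; split=> //; apply/F_free; exists v1.
  + by rewrite inner_cat inner_under.
  + by rewrite outer_cat outer_under; perm_count.
Qed.

(** Substitution and anti-substitution at once: each use in [u] stands for its own derivation of the
    term put in its place, so derivations can be plugged in as well as cut out. *)
Theorem typ_subst x M v A :
  typ (F x M) v A <-> exists2 u, typ M u A & distr (replaces x) u v.
Proof.
have const c : (forall x, F x c = c) ->
    (forall v A, typ c v A <-> A = TInert /\ v = [::]) ->
    forall x v A, typ (F x c) v A <-> exists2 u, typ c u A & distr (replaces x) u v.
  move=> Fc tc y w B; rewrite Fc; split.
    by move=> H; have [_ E] := (tc _ _).1 H; exists [::]; rewrite /= -?E.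
  by case=> u H; have [_ E] := (tc _ _).1 H; move: H; rewrite E /= => H ->.
have abs p y w B P Q :
    (forall v A, Q v A <-> exists2 u, P u A & distr (replaces (next y)) u v) ->
    ((exists w' B', [/\ Q w' B', abs_ty p B B' (inner w') & perm_eq w (outer w')])
     <-> exists2 u, (exists w' B', [/\ P w' B', abs_ty p B B' (inner w')
                                  & perm_eq u (outer w')])
                 & distr (replaces y) u w).
  move=> PQ; split.
    case=> w' [B' [/PQ [u Pu /distr_replaces_outer [E D]] Hp E']].
    exists (outer u); last by apply: distr_perm D; rewrite perm_sym.
    by exists u, B'; split=> //; apply: abs_ty_perm Hp.
  case=> u [w' [B' [Pw Hp /distr_perm_index E]]] /E /distr_replaces_body [v' [D E1 E2]].
  exists v', B'; split=> //; first by apply/PQ; exists w'.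
  by apply: abs_ty_perm Hp; rewrite perm_sym.
elim/term_nested_ind: M x v A.
- by move=> y; apply: const.
- move=> k i x v A /=; split.
    by move=> H; exists [:: Use k i A] => //=; exists v, [::]; rewrite cats0.
  case=> _ -> /= [v1 [_ [H -> E]]]; rewrite cats0 in E.
  by apply: typ_perm H; rewrite perm_sym.
- by move=> y; apply: const.
- move=> M IH x v A; rewrite F_Bang /=; split.
    case=> m -> /(distr_comp (P := fun B v => typ M v B) (S := replaces x)) [].
      by move=> B w _; apply: IH.
    by move=> u H1 H2; exists u => //; exists m.
  case=> u [m -> H1] H2; exists m => //.
  apply/(distr_comp (P := fun B v => typ M v B) (S := replaces x)).
    by move=> B w _; apply: IH.
  by exists u.
- by move=> y; apply: const.
- by move=> y; apply: const.
- move=> M IH x v A; rewrite F_New /=; split.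
    case=> -> [B [w [/IH [u Hu D] E]]]; exists (Cost :: u) => /=.
      by split=> //; exists B, u.
    by exists [:: Cost], w.
  case=> u [-> [B [w [Hw /distr_perm_index E]]]] /E [v1 [v2 [-> D E']]]; split=> //.
  by exists B, v2; split=> //; apply/IH; exists w.
- move=> M N IH1 IH2 x v A; rewrite F_App /=; split.
    case=> T [B [v1 [v2 [H /IH1 [u1 H1 D1] /IH2 [u2 H2 D2] E]]]].
    exists (Cost :: u1 ++ u2); first by exists T, B, u1, u2.
    exists [:: Cost], (v1 ++ v2); split=> //.
    by apply/distr_cat; exists v1, v2.
  case=> u [T [B [u1 [u2 [H H1 H2 /distr_perm_index E]]]]].
  case/E=> v1 [v2 [-> /distr_cat [v3 [v4 [D1 D2 E1]]] E2]].
  exists T, B, v3, v4; split=> //; last by perm_count.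
    by apply/IH1; exists u1.
  by apply/IH2; exists u2.
- move=> Ms IH x v A; rewrite F_Tup /= distr_map.
  have H := @distr_comp _ (fun M v => exists B, typ M v B) (fun M v => exists B, typ (F x M) v B) (replaces x) Ms v.
  rewrite H; last first.
    move=> M w HM; split=> [[B /(IH M HM) [u ? ?]]|[u [B ?] ?]].
      by exists u => //; exists B.
    by exists B; apply/(IH M HM); exists u.
  by split=> [[-> [u ? ?]]|[u [-> ?] ?]]; [exists u | split=> //; exists u].
- by move=> M IH x v A; rewrite F_LamBang; apply: abs => w B; apply: IH.
- by move=> p M IH x v A; rewrite F_LamPat; apply: abs => w B; apply: IH.
Qed.

End Substitution.

(** The instance in which every image is a single use. It then supplies the hypothesis on free
    references for [inst], which lifts its substituends under binders. *)
Lemma typ_lift M v A : typ (lift_term 0 M) v A <->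
  exists2 u, typ M u A & perm_eq v (map under u).
Proof.
have D u w : distr (replaces lift_term 0) u w <-> perm_eq w (map under u).
  elim: u w => [|t u IH] w /=.
    by split=> [->|/perm_nilP].
  have t1 v1 : replaces lift_term 0 t v1 <-> v1 = [:: under t] by case: t.
  split=> [[v1 [v2 [/t1 -> /IH H E]]]|E].
    by rewrite (perm_trans E) //= perm_cons.
  exists [:: under t], (map under u); split=> //; first exact/t1.
  exact/IH.
rewrite (@typ_subst nat S lift_term) //.
- by split=> -[u H /D E]; exists u => //; apply/D.
- move=> c k i w B; rewrite /= ltnS; case: ifP => _ /=.
    split=> [->|[_ -> E]]; first by exists [:: Use k i B].
    by apply: perm_small_eq E.
  split=> [->|[_ -> E]]; first by exists [:: Use k.+1 i B].
  by apply: perm_small_eq E.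
Qed.

Lemma typ_inst c Ns M v A : typ (inst c Ns M) v A <->
  exists2 u, typ M u A & distr (replaces (fun x => inst x.1 x.2) (c, Ns)) u v.
Proof.
apply: (@typ_subst _ (fun x => (x.1.+1, map (lift_term 0) x.2))
                     (fun x => inst x.1 x.2) _ _ _ _ _ _ _ _ _ _ _ _ (c, Ns)) => //=.
move=> [b Ls] k i w B /=; rewrite ltnS eqSS nth_lift.
case: ltngtP => kb.
- split=> [->|[_ -> E]]; first by exists [:: Use k i B].
  by apply: perm_small_eq E.
- case: k kb => // k _ /=; split=> [->|[_ -> E]]; first by exists [:: Use k i B].
  by apply: perm_small_eq E.
- exact: typ_lift.
Qed.

Lemma typ_inst0 Ns M v A : typ (inst 0 Ns M) v A <->
  exists w d,
    [/\ typ M w A,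
        distr (fun x D => typ (nth (Bit false) Ns x.1) D x.2) (inner w) d
      & perm_eq v (outer w ++ d)].
Proof.
have D w v' : distr (replaces (fun x => inst x.1 x.2) (0, Ns)) w v' <->
    exists2 d, distr (fun x D => typ (nth (Bit false) Ns x.1) D x.2) (inner w) d
             & perm_eq v' (outer w ++ d).
  elim: w v' => [|t w IH] v' /=.
    by split=> [->|[_ -> /perm_nilP]]; first by exists [::].
  case: t => [|[|k] i B] /=.
  - split=> [[v1 [v2 [-> /IH [d Hd E] E']]]|[d Hd E]]; first by exists d => //; perm_count.
    by exists [:: Cost], (outer w ++ d); split=> //; apply/IH; exists d.
  - split=> [[v1 [v2 [H1 /IH [d Hd E] E']]]|[d [v1 [v2 [H1 H2 E']] E]]].
      by exists (v1 ++ d); [exists v1, d | perm_count].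
    exists v1, (outer w ++ v2); split=> //; last by perm_count.
    by apply/IH; exists v2.
  - split=> [[v1 [v2 [-> /IH [d Hd E] E']]]|[d Hd E]]; first by exists d => //; perm_count.
    by exists [:: Use k i B], (outer w ++ d); split=> //; apply/IH; exists d.
rewrite typ_inst; split=> [[w H /D [d Hd E]]|[w [d [H Hd E]]]]; first by exists w, d.
by exists w => //; apply/D; exists d.
Qed.

(** * Counting the uses of linear variables *)

Definition uses (k i : nat) (t : resource) : bool :=
  if t is Use l j _ then (k == l) && (i == j) else false.

Lemma count_uses_outer k i w : count (uses k i) (outer w) = count (uses k.+1 i) w.
Proof. by elim: w => //= -[|[|l] j A] w /= ->. Qed.

Lemma count_uses_inner i w : count (fun x => i == x.1) (inner w) = count (uses 0 i) w.
Proof. by elim: w => //= -[|[|l] j A] w /= ->. Qed.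

(** The content of a [!] is typed any number of times; the doubling in [occ] turns the bound into
    [occ k i M = 0] there, so no copy has a use. *)
Lemma count_uses k i M u A :
  typ M u A -> occ k i M <= 1 -> count (uses k i) u = occ k i M.
Proof.
elim/term_nested_ind: M k u A => /=; try by move=> x k u A [_ ->].
- by move=> l j k u A -> _ /=; rewrite addn0.
- move=> M IH k u A [m _ Hm] o; have o0 : occ k i M = 0 by lia.
  rewrite o0 double0; elim: m u Hm => [|B m IHm] u /=; first by move=> ->.
  by case=> v1 [v2 [H1 /IHm H2 /permP ->]]; rewrite count_cat H2 (IH k _ B) ?o0.
- by move=> M IH k u A [_ [B [v [Hv /permP ->]]]] o /=; rewrite (IH _ _ B).
- move=> M N IH1 IH2 k u A [T [B [v1 [v2 [_ H1 H2 /permP ->]]]]] o /=.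
  by rewrite count_cat (IH1 k _ T) ?(IH2 k _ B) //; lia.
- move=> Ms IH k u A [_]; elim: Ms IH u => [|M Ms IHs] IH u /=; first by move=> ->.
  case=> v1 [v2 [[B H1] H2 /permP ->]] o.
  rewrite count_cat (IH M (or_introl erefl) k _ B) ?IHs //; try by lia.
  by move=> N HN; apply: IH; right.
- by move=> M IH k u A [w [B [H1 _ /permP ->]]] o; rewrite count_uses_outer (IH _ _ B).
- by move=> p M IH k u A [w [B [H1 _ /permP ->]]] o; rewrite count_uses_outer (IH _ _ B).
Qed.

Lemma inner_single M w A : typ M w A -> (forall i, occ 0 i M = (i < 1)) ->
  exists B, inner w = [:: (0, B)].
Proof.
move=> H o; have c i : count (fun x => i == x.1) (inner w) = (i < 1).
  by rewrite count_uses_inner (count_uses H) o ?leq_b1.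
case: (inner w) c => [|[[|i] B] l] c; first by move: (c 0).
  case: l c => [|[i C] l] c; first by exists B.
  by move: (c i) (c 0) => {c} /=; rewrite eqxx; case: i => [|i] /=; lia.
by move: (c i.+1); rewrite /= eqxx.
Qed.

Lemma inner_zero M w A : typ M w A -> (forall i, 0 < i -> occ 0 i M = 0) ->
  inner w = [seq (0, B) | B <- map snd (inner w)].
Proof.
move=> H o; have c i : 0 < i -> count (fun x => i == x.1) (inner w) = 0.
  by move=> i0; rewrite count_uses_inner (count_uses H) o.
elim: (inner w) c => //= -[i B] l IH c; rewrite -IH; last by move=> j /c /=; lia.
by case: i c => // i /(_ i.+1 isT); rewrite /= eqxx.
Qed.

(** An abstraction has an arrow type, so the inert case of [app_ty] cannot occur and the type of the
    body is the type of the whole. *)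
Lemma typ_let p M N u A : typ (App (LamPat p M) N) u A <->
  exists w B v,
    [/\ typ M w A, arg_ty p B (inner w), typ N v B & perm_eq u (Cost :: outer w ++ v)].
Proof.
split=> /=.
  case=> T [B [v1 [v2 [H [w [B' [H1 [C ET Hp] E1]]] H2 E]]]].
  case: H => [|[]]; rewrite ET // => -[EC EB]; rewrite EC in Hp; rewrite EB in H1.
  by exists w, B, v2; split=> //; perm_count.
case=> w [B [v [H1 Hp H2 E]]]; exists (TArr B A), B, (outer w), v.
split=> //; first by left.
by exists w, A; split=> //; exists B.
Qed.

(** * Weight and cost of a reduction step *)

Fixpoint kweight (M : term) : nat :=
  match M with
  | App M N => kweight M * kweight N
  | New M | LamBang M | LamPat _ M => (kweight M).+1
  | Tup Ms => (sumn (map kweight Ms)).+2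
  | FVar _ | BVar _ _ | QVar _ | Bit _ | Gate _ | Bang _ => 2
  end.

(** For weights [l], [m], [n], a commutation of [L] turns [l * ((m + 1) * n)] into
    [(l * m + 1) * n]: smaller, as [l] is at least 2 and [n] is positive. The offset 2 of tuples
    secures the bound even with no component. *)
Lemma kweight_gt1 M : 1 < kweight M.
Proof. by elim/term_nested_ind: M => //= M; lia. Qed.

Lemma kweight_lift c M : kweight (lift_term c M) = kweight M.
Proof.
elim/term_nested_ind: M c => //=.
- by move=> k i c; case: ifP.
- by move=> M IH c; rewrite IH.
- by move=> M N IH1 IH2 c; rewrite IH1 IH2.
- move=> Ms IH c; rewrite -map_comp; congr (sumn _).+2.
  by apply: List.map_ext_in => M /IH /= ->.
- by move=> M IH c; rewrite IH.
- by move=> p M IH c; rewrite IH.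
Qed.

Lemma kweight_rename_q s M : kweight (rename_q s M) = kweight M.
Proof.
elim/term_nested_ind: M => //=.
- by move=> M ->.
- by move=> M N -> ->.
- move=> Ms IH; rewrite -map_comp; congr (sumn _).+2.
  by apply: List.map_ext_in => M /IH /= ->.
- by move=> M ->.
- by move=> p M ->.
Qed.

(** Subject reduction from left to right, subject expansion from right to left. The type is
    arbitrary, so that the relation passes through every reduction context. *)
Definition cost_step (b : nat) (M M' : term) : Prop :=
  forall u A, typ M u A <->
    exists2 u', typ M' u' A & perm_eq u (nseq b Cost ++ u').

Lemma inner_costs b u : inner (nseq b Cost ++ u) = inner u.
Proof. by elim: b. Qed.

Lemma outer_costs b u : outer (nseq b Cost ++ u) = nseq b Cost ++ outer u.
Proof. by elim: b => //= b ->. Qed.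

Lemma cost_step_abs b M M' p u A : cost_step b M M' ->
  ((exists w B, [/\ typ M w B, abs_ty p A B (inner w) & perm_eq u (outer w)]) <->
   exists2 u', exists w B, [/\ typ M' w B, abs_ty p A B (inner w) & perm_eq u' (outer w)]
             & perm_eq u (nseq b Cost ++ u')).
Proof.
move=> MM'; split.
  case=> w [B [/MM' [w' H E] Hp Eu]].
  have := inner_perm E; have := outer_perm E; rewrite inner_costs outer_costs => Eo Ei.
  exists (outer w'); last by perm_count.
  by exists w', B; split=> //; apply: abs_ty_perm Hp.
case=> u' [w [B [H Hp E]] Eu]; exists (nseq b Cost ++ w), B; split.
- by apply/MM'; exists w.
- by rewrite inner_costs.
- by rewrite outer_costs; perm_count.
Qed.

Lemma cost_step_app_l b M M' N : cost_step b M M' -> cost_step b (App M N) (App M' N).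
Proof.
move=> MM' u A /=; split.
  case=> T [B [v1 [v2 [H /MM' [v1' H1 E1] H2 E]]]].
  exists (Cost :: v1' ++ v2); last by perm_count.
  by exists T, B, v1', v2.
case=> u' [T [B [v1 [v2 [H H1 H2 E]]]] Eu].
exists T, B, (nseq b Cost ++ v1), v2; split=> //; last by perm_count.
by apply/MM'; exists v1.
Qed.

Lemma cost_step_app_r b M N N' : cost_step b N N' -> cost_step b (App M N) (App M N').
Proof.
move=> NN' u A /=; split.
  case=> T [B [v1 [v2 [H H1 /NN' [v2' H2 E2] E]]]].
  exists (Cost :: v1 ++ v2'); last by perm_count.
  by exists T, B, v1, v2'.
case=> u' [T [B [v1 [v2 [H H1 H2 E]]]] Eu].
exists T, B, v1, (nseq b Cost ++ v2); split=> //; last by perm_count.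
by apply/NN'; exists v2.
Qed.

Lemma cost_step_new b M M' : cost_step b M M' -> cost_step b (New M) (New M').
Proof.
move=> MM' u A /=; split.
  case=> -> [B [v [/MM' [v' H E'] E]]]; exists (Cost :: v'); last by perm_count.
  by split=> //; exists B, v'.
case=> u' [-> [B [v [H E]]] Eu]; split=> //.
exists B, (nseq b Cost ++ v); split; last by perm_count.
by apply/MM'; exists v.
Qed.

Lemma cost_step_tuple b M M' Ms Ns : cost_step b M M' ->
  cost_step b (Tup (Ms ++ M :: Ns)) (Tup (Ms ++ M' :: Ns)).
Proof.
move=> MM' u A /=; split.
  case=> -> /distr_cat [v1 [v2 [H1 [v3 [v4 [[B /MM' [v3' H3 E3]] H4 E2]]] E]]].
  exists (v1 ++ v3' ++ v4); last by perm_count.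
  split=> //; apply/distr_cat; exists v1, (v3' ++ v4); split=> //.
  by exists v3', v4; split=> //; exists B.
case=> u' [-> /distr_cat [v1 [v2 [H1 [v3 [v4 [[B H3] H4 E2]]] E]]]] Eu; split=> //.
apply/distr_cat; exists v1, (nseq b Cost ++ v3 ++ v4); split=> //; last by perm_count.
exists (nseq b Cost ++ v3), v4; split=> //; last by perm_count.
by exists B; apply/MM'; exists v3.
Qed.

Lemma cost_step_lbeta M N : (forall i, occ 0 i M = (i < 1)) ->
  cost_step 1 (App (LamPat SVar M) N) (inst 0 [:: N] M).
Proof.
move=> o u A; rewrite typ_let; split.
  case=> w [B [v [H1 Hp H2 E]]]; exists (outer w ++ v) => //.
  apply/typ_inst0; exists w, v; split=> //.
  rewrite /= perm_sym in Hp; apply: (distr_perm_index Hp).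
  by exists v, [::]; rewrite cats0.
case=> u' /typ_inst0 [w [d [H Hd E]]] Eu.
(* The rule for [\x] provides exactly one derivation of the argument: linearity ensures that the
   body asks for exactly one. *)
have [B Ew] := inner_single H o.
move: Hd; rewrite Ew => -[v1 [v2 [H1 -> E1]]].
by exists w, B, v1; split=> //=; [rewrite Ew | perm_count].
Qed.

Lemma cost_step_qbeta n M rs :
  cost_step 1 (App (LamPat (STup n) M) (Tup (map QVar rs))) (inst 0 (map QVar rs) M).
Proof.
(* Quantum variables, like the default [Bit false], have only the type [TInert] and no resources, so
   they serve any number of uses provided that all are inert. *)
have rq i D A : typ (nth (Bit false) (map QVar rs) i) D A <-> A = TInert /\ D = [::].
  by elim: rs i => [|r rs IH] [|i] /=.
have tq v : distr (fun M v => exists B, typ M v B) (map QVar rs) v <-> v = [::].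
  elim: rs v {rq} => //= r rs IH v; split.
    by case=> v1 [v2 [[B [_ ->]] /IH -> /perm_nilP]].
  by move=> ->; exists [::], [::]; split=> //; [exists TInert | apply/IH].
have dq l d : distr (fun x D => typ (nth (Bit false) (map QVar rs) x.1) D x.2) l d <->
    all (fun x => x.2 == TInert) l /\ d = [::].
  elim: l d => [|[i B] l IH] d /=; first by split=> [|[]].
  split.
    by case=> v1 [v2 [/rq [-> ->] /IH [-> ->] /perm_nilP]]; rewrite eqxx.
  case=> /andP [/eqP -> Hl] ->; exists [::], [::]; split=> //; first exact/rq.
  exact/IH.
move=> u A; rewrite typ_let; split.
  case=> w [B [v [H1 Hp [_ /tq Ev] E]]]; rewrite Ev in E; exists (outer w); last by perm_count.
  by apply/typ_inst0; exists w, [::]; split=> //; [apply/dq | rewrite cats0].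
case=> u' /typ_inst0 [w [d [H /dq [Hd Ed] E]]] Eu; rewrite Ed in E.
exists w, TInert, [::]; split=> //; last by perm_count.
by split=> //; apply/tq.
Qed.

Lemma cost_step_cbeta M N : (forall i, 0 < i -> occ 0 i M = 0) ->
  cost_step 1 (App (LamBang M) (Bang N)) (inst 0 [:: N] M).
Proof.
move=> o u A; split=> /=.
  case=> T [B [v1 [v2 [H [w [B' [H1 Hp E1]]] [m EB H2] E]]]].
  (* Both stuck alternatives are excluded: that of [app_ty] because an abstraction has an arrow
     type, that of [abs_ty] because a [!] has only types [TBang]. *)
  have ET : T = TArr B A.
    by case: H => // -[nT _]; case: Hp => -[? ET _]; rewrite ET in nT.
  rewrite ET EB in Hp; case: Hp => [[m' [Em EA] Ew]|[C [EC _] nC]]; last first.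
    by rewrite -EC in nC.
  rewrite -EA -Em in H1 Ew.
  exists (outer w ++ v2); last by perm_count.
  apply/typ_inst0; exists w, v2; split=> //.
  by rewrite perm_sym in Ew; apply: (distr_perm_index Ew); rewrite distr_map.
case=> u' /typ_inst0 [w [d [H Hd E]]] Eu.
(* The intersection for the [!] is read off the body: all uses bear index 0, so their types
   determine [inner w]. *)
have Ew := inner_zero H o; rewrite Ew distr_map /= in Hd.
exists (TArr (TBang (map snd (inner w))) A), (TBang (map snd (inner w))), (outer w), d.
split; last by perm_count.
- by left.
- by exists w, A; split=> //; left; exists (map snd (inner w)) => //; rewrite {1}Ew.
- by exists (map snd (inner w)).
Qed.

Lemma typ_qtuple rs u A : typ (qtuple rs) u A <-> A = TInert /\ u = [::].
Proof.
have tq v : distr (fun M v => exists B, typ M v B) (map QVar rs) v <-> v = [::].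
  elim: rs v => //= r rs IH v; split.
    by case=> v1 [v2 [[B [_ ->]] /IH -> /perm_nilP]].
  by move=> ->; exists [::], [::]; split=> //; [exists TInert | apply/IH].
case: rs tq => [|r [|r' rs]] tq; last by split=> [[-> /tq]|[-> E]] //; split=> //; apply/tq.
all: by split=> -[].
Qed.

Lemma cost_step_uq i rs : cost_step 1 (App (Gate i) (qtuple rs)) (qtuple rs).
Proof.
move=> u A; split=> /=.
  case=> T [B [v1 [v2 [H [ET ->] /typ_qtuple [_ ->] E]]]].
  exists [::] => //; apply/typ_qtuple; split=> //.
  by move: H; rewrite /app_ty ET; case=> // -[].
case=> u' /typ_qtuple [-> ->] E; exists TInert, TInert, [::], [::]; split=> //.
  by right.
by apply/typ_qtuple.
Qed.

Lemma cost_step_newbit c r : cost_step 1 (New (Bit c)) (QVar r).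
Proof.
move=> u A; split=> /=.
  by case=> -> [B [v [[_ ->] E]]]; exists [::].
by case=> u' [-> ->] E; split=> //; exists TInert, [::].
Qed.

Lemma arg_ty_perm p B l l' : perm_eq l l' -> arg_ty p B l -> arg_ty p B l'.
Proof.
case: p => [|n] ll' /=; last by rewrite (perm_all _ ll').
by rewrite perm_sym in ll'; apply: perm_trans.
Qed.

(** The lifted [L] has no use of the variables of [p], so [arg_ty] examines the uses in [M] on both
    sides; each side adds two applications to its parts. *)
Lemma cost_step_lcm p L M N :
  cost_step 0 (App L (App (LamPat p M) N)) (App (LamPat p (App (lift_term 0 L) M)) N).
Proof.
move=> u A; split.
  case=> T [B [v1 [v2 [H H1 /typ_let [w [C [v [H2 Hp H3 E2]]]] E]]]].
  exists u => //; apply/typ_let; exists (Cost :: map under v1 ++ w), C, v.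
  split=> //.
  + exists T, B, (map under v1), w; split=> //.
    by apply/typ_lift; exists v1.
  + by rewrite /= inner_cat inner_under.
  + by rewrite /= outer_cat outer_under; perm_count.
case=> u' /typ_let [w [C [v [[T [B [v1 [v2 [H /typ_lift [v0 H0 E0] H2 E1]]]]] Hp H3 E]]]] Eu.
have Ei := inner_perm E0; have Eo := outer_perm E0.
have := inner_perm E1; have := outer_perm E1.
rewrite inner_under in Ei; rewrite outer_under in Eo.
rewrite /= inner_cat outer_cat => Eo1 Ei1.
exists T, B, v0, (Cost :: outer v2 ++ v); split=> //; last by perm_count.
apply/typ_let; exists v2, C, v; split=> //.
by apply: arg_ty_perm Hp; perm_count.
Qed.

Lemma cost_step_rcm p L M N :
  cost_step 0 (App (App (LamPat p M) N) L) (App (LamPat p (App M (lift_term 0 L))) N).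
Proof.
move=> u A; split.
  case=> T [B [v1 [v2 [H /typ_let [w [C [v [H2 Hp H3 E2]]]] H1 E]]]].
  exists u => //; apply/typ_let; exists (Cost :: w ++ map under v2), C, v.
  split=> //.
  + exists T, B, w, (map under v2); split=> //.
    by apply/typ_lift; exists v2.
  + by rewrite /= inner_cat inner_under cats0.
  + by rewrite /= outer_cat outer_under; perm_count.
case=> u' /typ_let [w [C [v [[T [B [v1 [v2 [H H2 /typ_lift [v0 H0 E0] E1]]]]] Hp H3 E]]]] Eu.
have Ei := inner_perm E0; have Eo := outer_perm E0.
have := inner_perm E1; have := outer_perm E1.
rewrite inner_under in Ei; rewrite outer_under in Eo.
rewrite /= inner_cat outer_cat => Eo1 Ei1.
exists T, B, (Cost :: outer v1 ++ v), v0; split=> //; last by perm_count.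
apply/typ_let; exists v1, C, v; split=> //.
by apply: arg_ty_perm Hp; perm_count.
Qed.

Lemma red_cost (R : realType) (G : gates R) C D :
  red G C D -> linear_term (conf_term C) ->
  exists b, cost_step b (conf_term C) (conf_term D) /\
            (b = 0 -> kweight (conf_term D) < kweight (conf_term C)).
Proof.
elim=> {C D} /=.
- by move=> QV Q M N [[_ o] _]; exists 1; split=> //; apply: cost_step_lbeta.
- by move=> QV Q M rs _; exists 1; split=> //; apply: cost_step_qbeta.
- by move=> QV Q M N [[_ o] _]; exists 1; split=> //; apply: cost_step_cbeta.
- by move=> QV Q i rs _; exists 1; split=> //; apply: cost_step_uq.
- by move=> QV Q r c _ _; exists 1; split=> //; apply: cost_step_newbit.
- move=> QV Q p L M N _; exists 0; split; first exact: cost_step_lcm.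
  move=> _; rewrite kweight_lift.
  by have := kweight_gt1 L; have := kweight_gt1 M; have := kweight_gt1 N; nia.
- move=> QV Q p L M N _; exists 0; split; first exact: cost_step_rcm.
  move=> _; rewrite kweight_lift.
  by have := kweight_gt1 L; have := kweight_gt1 M; have := kweight_gt1 N; nia.
- move=> QV QV' Q Q' M M' Ms Ns _ IH /(linear_tuple (_ ++ _)) lMs.
  have [|b [MM' lt]] := IH; first by apply: lMs; apply/List.in_app_iff; right; left.
  exists b; split=> [|/lt]; first exact: cost_step_tuple.
  by rewrite !map_cat !sumn_cat /=; lia.
- move=> QV QV' Q Q' M M' N _ IH [/IH [b [MM' lt]] _].
  exists b; split=> [|/lt]; first exact: cost_step_app_l.
  by have := kweight_gt1 N; nia.
- move=> QV QV' Q Q' M N N' _ IH [_ /IH [b [NN' lt]]].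
  exists b; split=> [|/lt]; first exact: cost_step_app_r.
  by have := kweight_gt1 M; nia.
- move=> QV QV' Q Q' M M' _ IH /IH [b [MM' lt]].
  by exists b; split=> //; apply: cost_step_new.
- move=> QV QV' Q Q' M M' _ IH [/IH [b [MM' lt]] _].
  by exists b; split=> // u A; apply: (cost_step_abs None u A MM').
- move=> QV QV' Q Q' p M M' _ IH [/IH [b [MM' lt]] _].
  by exists b; split=> // u A; apply: (cost_step_abs (Some p) u A MM').
Qed.

(** * Normal forms *)

Definition inert_use (t : resource) : bool :=
  if t is Use _ _ A then A == TInert else true.

Definition is_bang_term (M : term) : bool := if M is Bang _ then true else false.
Definition is_lam (M : term) : bool :=
  match M with LamBang _ | LamPat _ _ => true | _ => false end.
Definition is_let (M : term) : bool := if M is App (LamPat _ _) _ then true else false.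

(** A let takes the type of its body, which may be anything, whence the exemption. It is harmless: a
    let on either side of an application is a commutation redex. *)
Definition inert_typable (M : term) : Prop :=
  exists u A, [/\ typ M u A, all inert_use u,
                  ~~ is_let M -> ~~ is_bang_term M -> not_bang A
                & ~~ is_let M -> ~~ is_lam M -> not_arr A].

Lemma inert_inner w : all inert_use w -> all (fun x => x.2 == TInert) (inner w).
Proof. by elim: w => //= -[|[|k] i A] w IH //= /andP [? /IH ->]; rewrite ?andbT. Qed.

Lemma inert_outer w : all inert_use w -> all inert_use (outer w).
Proof. by elim: w => //= -[|[|k] i A] w IH //= /andP [? /IH ->]; rewrite ?andbT. Qed.

Definition irreducible (R : realType) (G : gates R) QV (Q : hilb R QV) (M : term) :=
  forall D, ~ red G (Conf Q M) D.

Lemma irreducible_inert_typable (R : realType) (G : gates R) QV (Q : hilb R QV) M :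
  linear_term M -> irreducible G Q M -> inert_typable M.
Proof.
(* The hypothesis on an abstraction leaves its argument type unknown, but once applied to [N] it
   must accept the type of [N]: its body has to be abstracted anew, so the hypothesis on the body is
   kept too. *)
suff: (linear_term M -> irreducible G Q M -> inert_typable M) /\
      match M with
      | LamBang P | LamPat _ P => linear_term P -> irreducible G Q P -> inert_typable P
      | _ => True
      end by case.
elim/term_nested_ind: M => /=.
- by move=> x; split=> // _ _; exists [::], TInert.
- move=> k i; split=> // _ _; exists [:: Use k i TInert], TInert; split=> //=.
  by rewrite eqxx.
- by move=> r; split=> // _ _; exists [::], TInert.
(* The empty intersection: the content of a [!] may diverge and is left untyped. *)
- by move=> M _; split=> // _ _; exists [::], (TBang [::]); split=> //=; exists [::].
- by move=> b; split=> // _ _; exists [::], TInert.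
- by move=> i; split=> // _ _; exists [::], TInert.
- move=> M [IH _]; split=> // lM irr.
  have [|u [A [H1 H2 _ _]]] := IH lM.
    by move=> [QV' Q' M'] r; apply: (irr (Conf Q' (New M'))); constructor.
  exists (Cost :: u), TInert; split=> //=; split=> //.
  by exists A, u.
- move=> M N [IH1 IHM] [IH2 _]; split=> // -[lM lN] irr.
  have irrM : irreducible G Q M.
    by move=> [QV' Q' M'] r; apply: (irr (Conf Q' (App M' N))); constructor.
  have irrN : irreducible G Q N.
    by move=> [QV' Q' N'] r; apply: (irr (Conf Q' (App M N'))); constructor.
  have [u2 [B [H2 I2 nb2 _]]] := IH2 lN irrN.
  have nlN : ~~ is_let N.
    case: N irr {IH2 lN irrN H2 nb2} => // -[] //= p P N irr.
    by case: (irr (Conf Q (App (LamPat p (App (lift_term 0 M) P)) N))); constructor.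
  have [u1 [T [H1 I1 _ na1]]] := IH1 lM irrM.
  case lam: (is_lam M); last first.
    have nlM : ~~ is_let M.
      case: M irr {IH1 IHM lM irrM H1 na1 lam} => // -[] //= p P L irr.
      by case: (irr (Conf Q (App (LamPat p (App P (lift_term 0 N))) L))); constructor.
    exists (Cost :: u1 ++ u2), TInert; split=> //=; last by rewrite all_cat I1.
    exists T, B, u1, u2; split=> //; right; split=> //.
    by apply: na1 => //; rewrite lam.
  case: M lam lM irr irrM {IH1 H1 na1 T u1 I1} IHM => //=.
    move=> P _ [lP _] irr irrM IHP.
    have [|w [A [H1 I1 _ _]]] := IHP lP.
      by move=> [QV' Q' P'] r; apply: (irrM (Conf Q' (LamBang P'))); constructor.
    exists (Cost :: outer w ++ u2), TInert; split=> //=; last first.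
      by rewrite all_cat inert_outer.
    exists (TArr B TInert), B, (outer w), u2; split=> //; first by left.
    (* [N] is not a [!], which would make a redex, nor a let, so [B] is not a [!] type and the stuck
       case of [abs_ty] applies. *)
    exists w, A; split=> //; right; exists B => //; apply: nb2 => //.
    case: N irr {IH2 lN irrN H2 nlN} => // N irr.
    by case: (irr (Conf Q (inst 0 [:: N] P))); constructor.
  move=> p P _ [lP _] irr irrM IHP.
  have [|w [A [H1 I1 _ _]]] := IHP lP.
    by move=> [QV' Q' P'] r; apply: (irrM (Conf Q' (LamPat p P'))); constructor.
  exists (Cost :: outer w ++ u2), A; split=> //=; last by rewrite all_cat inert_outer.
  apply/(typ_let p P N); exists w, B, u2; split=> //.
  (* A variable pattern would make a redex; a tuple pattern only asks that the uses of its variables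
     be inert, whatever the type of [N]. *)
  case: p irr irrM => [|n] irr irrM; last exact: inert_inner.
  by case: (irr (Conf Q (inst 0 [:: N] P))); constructor.
- move=> Ms IH; split=> // /(linear_tuple Ms) lMs irr.
  suff [u H I] : exists2 u, distr (fun M v => exists B, typ M v B) Ms u & all inert_use u.
    by exists u, TInert.
  have {irr} irr M : List.In M Ms -> irreducible G Q M.
    move=> HM [QV' Q' M'] r; have [Ls [Ns E]] := List.in_split _ _ HM; move: irr; rewrite E => irr.
    by apply: (irr (Conf Q' (Tup (Ls ++ M' :: Ns)))); constructor.
  elim: Ms IH lMs irr => [|M Ms IHs] IH lMs irr /=; first by exists [::].
  have [|u H I] := IHs (fun N HN => IH N (or_intror HN)) (fun N HN => lMs N (or_intror HN)).
    by move=> N HN; apply: irr; right.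
  have [IHM _] := IH M (or_introl erefl).
  have [v [A [Hv Iv _ _]]] := IHM (lMs M (or_introl erefl)) (irr M (or_introl erefl)).
  exists (v ++ u); last by rewrite all_cat Iv.
  by exists v, u; split=> //; exists A.
- move=> M [IH _]; split=> // -[lM o] irr.
  have [|w [A [H I _ _]]] := IH lM.
    by move=> [QV' Q' M'] r; apply: (irr (Conf Q' (LamBang M'))); constructor.
  exists (outer w), (TArr TInert TInert); split=> //=; last exact: inert_outer.
  by exists w, A; split=> //; right; exists TInert.
- move=> p M [IH _]; split=> // -[lM o] irr.
  have [|w [A [H I _ _]]] := IH lM.
    by move=> [QV' Q' M'] r; apply: (irr (Conf Q' (LamPat p M'))); constructor.
  exists (outer w), (TArr TInert A); split=> //=; last exact: inert_outer.
  exists w, A; split=> //; exists TInert => //.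
  have Iw := inert_inner I; case: p o {irr} => [|n] o //=.
  have [B Ew] := inner_single H o.
  by move: Iw; rewrite Ew /= andbT => /eqP ->.
Qed.

(** * Configurations *)

(** All quantum variables have the same typings, so the renamings in [step] are invisible to
    types. *)
Lemma typ_rename_q s M : typ (rename_q s M) = typ M.
Proof.
elim/term_nested_ind: M => //=.
- by move=> M ->.
- by move=> M ->.
- by move=> M N -> ->.
- move=> Ms IH; apply/funext => u; apply/funext => A; rewrite distr_map.
  congr (_ /\ _); apply: propext; apply: distr_iff => M v HM.
  by rewrite IH.
- by move=> M ->.
- by move=> p M ->.
Qed.

Definition typable (M : term) : Prop := exists u A, typ M u A.

Lemma conf_equiv_refl (R : realType) (C : conf R) : conf_equiv C C.
Proof.
have rid M : rename_q id M = M.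
  elim/term_nested_ind: M => //=.
  - by move=> M ->.
  - by move=> M ->.
  - by move=> M N -> ->.
  - by move=> Ms IH; congr Tup; elim: Ms IH => //= M Ms IHs IH; rewrite IH ?IHs //; auto.
  - by move=> M ->.
  - by move=> p M ->.
exists id; split=> //.
- by exists id.
- by apply/fsetP => x; rewrite imfset_id.
- move=> f; congr (conf_reg C _); apply/ffunP => x; rewrite ffunE /lookup.
  by case: insubP => [y _ /val_inj ->|] //; rewrite (valP x).
Qed.

Lemma step_cost (R : realType) (G : gates R) C D :
  step G C D -> linear_term (conf_term C) ->
  linear_term (conf_term D) /\
  exists b, cost_step b (conf_term C) (conf_term D) /\
            (b = 0 -> kweight (conf_term D) < kweight (conf_term C)).
Proof.
case=> C' [D' [[s [_ _ EC _]] r [t [_ _ ED _]]]] lC.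
have lC' : linear_term (conf_term C') by rewrite EC; apply/linear_rename_q.
split; first by rewrite ED; apply/linear_rename_q; apply: red_linear r lC'.
have [b [H lt]] := red_cost r lC'; exists b; rewrite ED kweight_rename_q.
split; last by rewrite EC kweight_rename_q in lt.
by move=> u A; rewrite typ_rename_q -(H u A) EC typ_rename_q.
Qed.

Lemma typable_strongly_normalizing (R : realType) (G : gates R) (C : conf R) :
  linear_term (conf_term C) -> typable (conf_term C) -> strongly_normalizing G C.
Proof.
move=> lC [u [A H]].
move: {2}(count_mem Cost u) (erefl (count_mem Cost u)) => n En.
elim/ltn_ind: n u C lC H En => n IHn u C lC H En.
move: {2}(kweight (conf_term C)) (erefl (kweight (conf_term C))) => m Em.
elim/ltn_ind: m u C lC H En Em => m IHm u C lC H En Em [s [s0 Hs]].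
have st : step G C (s 1) by rewrite -s0.
have [l1 [b [/(_ u A) [/(_ H) [u' H' /permP E] _] lt]]] := step_cost st lC.
have tail : exists s', s' 0 = s 1 /\ forall i, step G (s' i) (s' i.+1).
  by exists (fun i => s i.+1).
(* Counting [Cost] gives [n = b + count_mem Cost u']: either the cost drops, or [b = 0] and the
   weight does. *)
have {E} := E (pred1 Cost); rewrite count_cat count_nseq En /= eqxx mul1n => E.
case: b lt E => [|b] lt E.
  by apply: (IHm (kweight (conf_term (s 1))) _ u' (s 1) l1 H' _ erefl tail); rewrite -?Em ?lt.
apply: (IHn (count_mem Cost u') _ u' (s 1) l1 H' erefl tail).
by rewrite E addSn ltnS leq_addl.
Qed.

Lemma normal_form_typable (R : realType) (G : gates R) (C : conf R) :
  linear_term (conf_term C) -> normal_form G C -> typable (conf_term C).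
Proof.
case: C => QV Q M /= lM nf.
have [|u [A [H _ _ _]]] := irreducible_inert_typable (G := G) (Q := Q) lM.
  by move=> D r; apply: nf; exists D, (Conf Q M), D; split=> //; apply: conf_equiv_refl.
by exists u, A.
Qed.

Lemma steps_typable (R : realType) (G : gates R) (C D : conf R) :
  clos_refl_trans _ (step G) C D -> linear_term (conf_term C) ->
  linear_term (conf_term D) /\ (typable (conf_term D) -> typable (conf_term C)).
Proof.
elim=> {C D} [C D st lC|//|C D E _ IH1 _ IH2 /IH1 [/IH2 [lE H2] H1]].
  have [lD [b [H _]]] := step_cost st lC; split=> // -[u [A Hu]].
  by exists (nseq b Cost ++ u), A; apply/H; exists u.
by split=> // /H2 /H1.
Qed.

Lemma strongly_weakly_normalizing (R : realType) (G : gates R) (C : conf R) :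
  strongly_normalizing G C -> weakly_normalizing G C.
Proof.
move=> sn; apply: contrapT => nwn; apply: sn.
(* If no normal form is reachable, every reachable configuration has a successor. Reachability sits
   inside the choice, so [next] is total and can be iterated before its iterates are known to be
   reachable. *)
have next D : { E | clos_refl_trans _ (step G) C D -> step G D E }.
  apply: cid; apply: contrapT => H.
  apply: nwn; exists D; split; first by apply: contrapT => HD; apply: H; exists D.
  by case=> E st; apply: H; exists E.
pose s := fix s n := if n is n.+1 then sval (next (s n)) else C.
have reach n : clos_refl_trans _ (step G) C (s n).
  elim: n => [|n IH]; first exact: rt_refl.
  by apply: (rt_trans _ _ _ _ _ IH); apply: rt_step; exact: (svalP (next (s n)) IH).
by exists s; split=> // i; exact: (svalP (next (s i)) (reach i)).
Qed.

Theorem mainTheorem8 (R : realType) (G : gates R) (C : conf R) :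
  well_formed C -> (strongly_normalizing G C <-> weakly_normalizing G C).
Proof.
move=> /well_formed_linear lC; split; first exact: strongly_weakly_normalizing.
case=> D [CD nf]; have [lD CDt] := steps_typable CD lC.
exact: typable_strongly_normalizing lC (CDt (normal_form_typable lD nf)).
Qed.
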